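(* Let $\gamma\colon[0,1]\to\mathbb{R}^2$ be a closed $\frac12$-Hölder curve such that $$\sum_{i=0}^\infty\sum_{j=0}^{2^i-1}\Big(\operatorname{diam}\big\{\gamma(j2^{-i}),\gamma((2j+1)2^{-i-1}),\gamma((j+1)2^{-i})\big\}\Big)^2<\infty.$$ Then $\mathcal{H}^2(\gamma([0,1]))=0$, $\operatorname{Wind}(\gamma,\cdot)\in L_1(\mathbb{R}^2)$, and $$\int_{\mathbb{R}^2}\operatorname{Wind}(\gamma,z)\,\mathrm{d}z=A(\gamma).$$
   Context: $\mathcal{H}^2$ is the Euclidean $2$-dimensional Hausdorff measure on $\mathbb{R}^2$. A curve is closed if $\gamma(0)=\gamma(1)$. Winding number: identify $\mathbb{R}^2\cong\mathbb{C}$. For $z\notin\gamma([0,1])$, $\operatorname{Wind}(\gamma,z)=\frac1{2\pi}(\theta_z(1)-\theta_z(0))$, where $\theta_z\colon[0,1]\to\mathbb{R}$ is any continuous function with $e^{i\theta_z(t)}=\frac{\gamma(t)-z}{|\gamma(t)-z|}$. Signed area: for a partition $P=\{t_1,\dots,t_k\}$, $0=t_1<\dots<t_k=1$, let $A_P(\gamma)=\frac12\sum_{i=1}^{k-1}(\gamma_1(t_i)\gamma_2(t_{i+1})-\gamma_2(t_i)\gamma_1(t_{i+1}))$ and $\operatorname{mesh}(P)=\max_i(t_{i+1}-t_i)$. $A(\gamma)=\lim_{\operatorname{mesh}(P)\to0}A_P(\gamma)$, i.e. $A(\gamma)$ exists and equals $L$ if for any $\epsilon>0$ there is $\delta>0$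 such that $\operatorname{mesh}(P)<\delta$ implies $|L-A_P(\gamma)|<\epsilon$. (Under the stated hypotheses $A(\gamma)$ exists.) *)

(* Defs.v *)
From HB Require Import structures.
From mathcomp Require Import all_boot all_order all_algebra.
From mathcomp Require Import all_classical all_reals all_analysis.

Set Implicit Arguments.
Unset Strict Implicit.
Unset Printing Implicit Defensive.

Import Order.TTheory GRing.Theory Num.Theory.
Import numFieldNormedType.Exports.

Local Open Scope classical_set_scope.
Local Open Scope ring_scope.

(* The library norm on [R * R] is the max norm; all metric notions below use
   the Euclidean norm instead. *)
Definition enorm {R : realType} (z : R * R) : R :=
  Num.sqrt (z.1 ^+ 2 + z.2 ^+ 2).

(* [maxe 0] only matters for the empty set, whose diameter is 0. *)
Definition ediam {R : realType} (A : set (R * R)) : \bar R :=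
  maxe 0%E (ereal_sup [set (enorm (x - y))%:E | x in A & y in A]).

(* The factor pi / 4 is the area of the disc of diameter 1, the usual
   normalization for which H^2 agrees with the Lebesgue measure of the plane. *)
Definition hausdorff2_pre {R : realType} (delta : R) (A : set (R * R)) : \bar R :=
  ereal_inf [set ((pi / 4)%:E * \sum_(0 <= k <oo) ediam (U k) ^+ 2)%E
            | U in [set U : nat -> set (R * R) |
                     A `<=` \bigcup_k U k
                     /\ forall k, (ediam (U k) <= delta%:E)%E]].

(* The limit as delta tends to 0 is a supremum, since [hausdorff2_pre delta A]
   is nonincreasing in delta. *)
Definition hausdorff2 {R : realType} (A : set (R * R)) : \bar R :=
  ereal_sup [set hausdorff2_pre delta A | delta in [set delta : R | 0 < delta]].

(* Curves [0, 1] -> R^2 are represented by functions on R of which only the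
   restriction to [0, 1] is ever used. *)
Definition holder_curve {R : realType} (alpha : R) (g : R -> R * R) : Prop :=
  exists C : R, forall s t : R, s \in `[0, 1] -> t \in `[0, 1] ->
    enorm (g s - g t) <= C * `|s - t| `^ alpha.

Definition closed_curve {R : realType} (g : R -> R * R) : Prop := g 0 = g 1.

Definition curve_image {R : realType} (g : R -> R * R) : set (R * R) :=
  g @` `[0, 1].

(* The equation e^(i theta t) = (g t - z) / |g t - z|, in coordinates. *)
Definition angle_function {R : realType} (g : R -> R * R) (z : R * R)
    (theta : R -> R) : Prop :=
  {within `[0, 1], continuous theta} /\
  forall t : R, t \in `[0, 1] ->
    (cos (theta t), sin (theta t)) =
    (((g t).1 - z.1) / enorm (g t - z), ((g t).2 - z.2) / enorm (g t - z)).

(* For a continuous curve the set below is a singleton when z is off the image.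
   On the image it is empty and the value is set to 0 by convention. *)
Definition wind {R : realType} (g : R -> R * R) (z : R * R) : R :=
  xget 0 [set w | ~ curve_image g z /\
    exists2 theta : R -> R, angle_function g z theta &
      w = (theta 1 - theta 0) / (2 * pi)].

(* [s] stands for the partition [0 :: s], as in [itv_partition 0 1 s]. *)
Definition partition_area {R : realType} (g : R -> R * R) (s : seq R) : R :=
  2^-1 * \sum_(i < size s)
    ((g (0 :: s)`_i).1 * (g (0 :: s)`_i.+1).2
     - (g (0 :: s)`_i).2 * (g (0 :: s)`_i.+1).1).

Definition partition_mesh {R : realType} (s : seq R) : R :=
  \big[Num.max/0]_(i < size s) ((0 :: s)`_i.+1 - (0 :: s)`_i).

(* The signed area of [g] exists and equals [L]. *)
Definition signed_area_is {R : realType} (g : R -> R * R) (L : R) : Prop :=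
  forall eps : R, 0 < eps ->
    exists2 delta : R, 0 < delta &
      forall s : seq R, itv_partition 0 1 s -> partition_mesh s < delta ->
        `|L - partition_area g s| < eps.

Definition dyadic_triple {R : realType} (g : R -> R * R) (i j : nat) :
    set (R * R) :=
  [set g (j%:R / 2 ^+ i); g ((2 * j + 1)%:R / 2 ^+ i.+1);
       g ((j + 1)%:R / 2 ^+ i)].

Definition lebesgue_plane {R : realType} :
    {measure set (measurableTypeR R * measurableTypeR R) -> \bar R} :=
  (@lebesgue_measure R \x @lebesgue_measure R)%E.

(* Main.v *)
Require Import Defs.
From mathcomp Require Import all_boot all_order all_algebra.
From mathcomp Require Import all_classical all_reals all_analysis.
From mathcomp Require Import measurable_realfun.
From mathcomp Require Import ring lra zify.
Import Order.TTheory GRing.Theory Num.Theory.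
Import numFieldNormedType.Exports.
Local Open Scope classical_set_scope.
Local Open Scope ring_scope.

Set Implicit Arguments.
Unset Strict Implicit.
Unset Printing Implicit Defensive.

(** Write [g] for the curve.  Let [P_m] be the closed polygon through the nodes
[g (j / 2 ^ m)], let [W_m] be its winding function and [A_m] its shoelace sum, so that the integral
of [W_m] is [A_m] ([integral_polygon_wind]).

Inserting the midpoints turns [P_m] into [P_(m+1)] and changes the winding
function by signed indicators of triangles, one for each dyadic triple of level
[m]; each of them lives in a square whose area is a multiple of the squared
diameter of the triple.  The summability hypothesis therefore bounds all the
[W_m] by one integrable function ([polygon_wind_dominated],
[integrable_wind_bound]).  Off the curve, [W_m z] is eventually equal to the
winding number of the curve about [z] ([wind_polygon]).  Since the curve is a
null set, dominated convergence shows that the winding function is integrable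
and that its integral is the limit of the [A_m] ([wind_integral]).

To see that the curve is small, descend from a node of level [n] to a point of
the curve through nodes of levels [n], [n + 1], ..., [n + M].  The squared
distance is at most a multiple, depending on [M], of the squared diameters of
the triples met on the way, plus a multiple of [2 ^- (n + M)] coming from the
Hölder condition.  Summed over the [2 ^ n] nodes, the second part is a multiple
of [2 ^- M], and for fixed [M] the first part is a tail of the given series.
Hence the curve is covered by squares of small total area ([squares_cover]),
which gives both the Hausdorff and the Lebesgue statement.

It remains to pass from dyadic partitions to all partitions.  A partition is
first moved to dyadic points of a very fine level [N], which changes its area
by as little as one likes.  Between two consecutive points, the fine polygon
and the chord enclose an area that the Hölder condition alone does not make
small: it bounds the contribution of each dyadic level by a multiple of the
length of the interval, with no gain for a small mesh.  Over the whole partition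
[polygon_refinement] gives the bound [K * tail + eps], where [K] depends
on [eps] but not on the partition: rounding the ends of the interval inward,
one level at a time, produces triangles over dyadic intervals, controlled by
the series, and two thin triangles at the ends.  In a thin triangle one side is
a chord of the current level; [absorb] charges it either to the square of that
chord, hence to the series, or to a small multiple of the length which decays
geometrically in the level. *)

Local Notation plane R := (measurableTypeR R * measurableTypeR R)%type.

(** The real hypotheses are dropped first: the preprocessing of [lia] would
otherwise try to interpret them, at great cost. *)
Ltac nlia :=
  match goal with
  | R : realType |- _ =>
    repeat match goal with
      H : ?T |- _ => match T with context [R] => clear H end
    end
  end; lia.

(** * Plane vectors *)

Definition cross {R : realType} (u v : R * R) : R := u.1 * v.2 - u.2 * v.1.

Lemma enorm_ge0 (R : realType) (u : R * R) : 0 <= enorm u.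
Proof. exact: sqrtr_ge0. Qed.

Lemma enorm_sqr (R : realType) (u : R * R) : enorm u ^+ 2 = u.1 ^+ 2 + u.2 ^+ 2.
Proof. by rewrite sqr_sqrtr// addr_ge0// sqr_ge0. Qed.

Lemma enormN (R : realType) (u : R * R) : enorm (- u) = enorm u.
Proof. by rewrite /enorm /= !sqrrN. Qed.

Lemma enorm_distC (R : realType) (u v : R * R) : enorm (u - v) = enorm (v - u).
Proof. by rewrite -enormN opprB. Qed.

Lemma enorm_fst (R : realType) (u : R * R) : `|u.1| <= enorm u.
Proof. by rewrite -sqrtr_sqr ler_wsqrtr// lerDl sqr_ge0. Qed.

Lemma enorm_snd (R : realType) (u : R * R) : `|u.2| <= enorm u.
Proof. by rewrite -sqrtr_sqr ler_wsqrtr// lerDr sqr_ge0. Qed.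

Lemma enorm_eq0 (R : realType) (u : R * R) : enorm u = 0 -> u = 0.
Proof.
move=> u0; have := enorm_fst u; have := enorm_snd u.
by case: u u0 => x y /= ->; rewrite !normr_le0 => /eqP -> /eqP ->.
Qed.

Lemma cross_enorm (R : realType) (u v : R * R) :
  `|cross u v| <= enorm u * enorm v.
Proof.
rewrite -[leRHS]ger0_norm ?mulr_ge0 ?enorm_ge0// -ler_sqr ?nnegrE//.
rewrite !real_normK ?num_real// exprMn !enorm_sqr /cross -subr_ge0.
rewrite (_ : _ - _ = (u.1 * v.1 + u.2 * v.2) ^+ 2) ?sqr_ge0//; ring.
Qed.

Lemma cross_sqr_le (R : realType) (u v : R * R) (e : R) :
  enorm u ^+ 2 <= e -> enorm v ^+ 2 <= e -> `|cross u v| <= e.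
Proof.
move=> ue ve; apply: le_trans (cross_enorm _ _) _.
have := sqr_ge0 (enorm u - enorm v); nra.
Qed.

(** * Polygons and their chords: refinement by halving *)

(** Twice the signed area enclosed by the polygon [G a], ..., [G b] and the
chord that closes it. *)
Definition fan {R : realType} (G : nat -> R * R) (a b : nat) : R :=
  \sum_(a <= j < b) cross (G j) (G j.+1) - cross (G a) (G b).

Lemma cross_self (R : realType) (u : R * R) : cross u u = 0.
Proof. by rewrite /cross mulrC subrr. Qed.

Lemma fan_short (R : realType) (G : nat -> R * R) (a b : nat) :
  (a <= b <= a.+1)%N -> fan G a b = 0.
Proof.
move=> ab; have [->|->] : b = a \/ b = a.+1 by lia.
- by rewrite /fan big_geq// cross_self subrr.
- by rewrite /fan big_nat1 subrr.
Qed.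

Lemma edge_short (R : realType) (G : nat -> R * R) (a b : nat) :
  (a <= b <= a.+1)%N ->
  \sum_(a <= j < b) cross (G j) (G j.+1) = cross (G a) (G b).
Proof. by move=> /(fan_short G)/eqP; rewrite subr_eq0 => /eqP. Qed.

Lemma big_nat_double (V : nmodType) (F : nat -> V) (a b : nat) :
  \sum_((2 * a)%N <= j < (2 * b)%N) F j =
  \sum_(a <= j < b) (F (2 * j)%N + F (2 * j).+1).
Proof.
have [ba|/ltnW ab] := leqP b a; first by rewrite !big_geq ?leq_mul2l.
elim: b ab => [|b IH] ab; first by rewrite !big_geq//; lia.
have [eab|nab] := eqVneq a b.+1; first by rewrite eab !big_geq.
have {}ab : (a <= b)%N by lia.
rewrite (_ : (2 * b.+1 = (2 * b).+2)%N); last by lia.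
by rewrite !big_nat_recr/= ?IH ?addrA//; lia.
Qed.

(** Both ends are rounded inward to even indices.  What is cut off consists of
one triangle over each coarse edge, and of two triangles with vertices
[G a], [F x], [G b] and [F x], [F y], [G b], in which the side at the rounded
end is an edge of [G] or a point. *)
Lemma fan_halving (R : realType) (F G : nat -> R * R) (a b : nat) :
  (forall j, G (2 * j)%N = F j) -> (a.+2 <= b)%N ->
  let x := uphalf a in let y := b./2 in
  fan G a b = fan F x y
    + \sum_(x <= j < y) cross (G (2 * j).+1 - F j) (F j.+1 - F j)
    + cross (F x - G a) (G b - F x) + cross (F y - F x) (G b - F y).
Proof.
move=> GF ab x y.
rewrite /fan (big_cat_nat (n := (2 * x)%N))/=; [|lia|lia].
rewrite (big_cat_nat (m := (2 * x)%N) (n := (2 * y)%N))/=; [|lia|lia].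
rewrite edge_short; last lia.
rewrite ((@edge_short _ _ (2 * y))); last lia.
rewrite big_nat_double !GF.
have step j : true -> cross (G (2 * j)%N) (G (2 * j).+1)
      + cross (G (2 * j).+1) (G (2 * j).+2)
    = cross (F j) (F j.+1) + cross (G (2 * j).+1 - F j) (F j.+1 - F j).
  by move=> _; rewrite -!GF (_ : (2 * j.+1 = (2 * j).+2)%N) /cross/=; [ring|lia].
rewrite (eq_bigr _ (fun j => step j)) big_split/= /cross/=; ring.
Qed.

(** If [C * e <= eta * h * p], the second term on the right suffices.
Otherwise [e <= C * p ^+ 2] gives [eta * h < C ^+ 2 * p], so that
[(eta * h) ^+ 2 <= C ^+ 3 * e] and the left side is at most a multiple of
[e ^+ 2]. *)
Lemma absorb (R : realType) (C eta e h p : R) :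
  0 <= C -> 0 < eta -> 0 <= e -> 0 <= h -> 0 <= p -> e <= C * p ^+ 2 ->
  C * h ^+ 2 * e <= C ^+ 4 / eta ^+ 2 * e ^+ 2 + eta * h ^+ 3 * p.
Proof.
move=> C0 eta0 e0 h0 p0 eCp; have eta0' := ltW eta0.
have K0 : 0 <= C ^+ 4 / eta ^+ 2 by rewrite divr_ge0 ?exprn_ge0.
have [small|large] := leP (C * e) (eta * h * p).
  have : 0 <= C ^+ 4 / eta ^+ 2 * e ^+ 2 by rewrite mulr_ge0 ?exprn_ge0.
  have : h ^+ 2 * (C * e) <= h ^+ 2 * (eta * h * p) by rewrite ler_wpM2l ?exprn_ge0.
  lra.
have t0 : 0 <= eta * h ^+ 3 * p by rewrite !mulr_ge0 ?exprn_ge0.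
suff : C * h ^+ 2 * e <= C ^+ 4 / eta ^+ 2 * e ^+ 2 by lra.
have p1 : 0 < p.
  rewrite lt_neqAle p0 andbT; apply/eqP => p1; move: eCp large; rewrite -p1.
  rewrite expr0n/= !mulr0 => e1; have -> : e = 0 by lra.
  by rewrite mulr0 ltxx.
have hp : eta * h < C ^+ 2 * p.
  rewrite -(ltr_pM2r p1); apply: (lt_le_trans large).
  have : C * e <= C * (C * p ^+ 2) by rewrite ler_wpM2l.
  lra.
have hh : eta * h * (eta * h) <= C ^+ 2 * p * (eta * h).
  by rewrite ler_wpM2r ?mulr_ge0// ltW.
have hhe : (eta * h) ^+ 2 <= C ^+ 2 * (C * e).
  apply: (le_trans (y := C ^+ 2 * (eta * h * p))); first by lra.
  by rewrite ler_wpM2l ?exprn_ge0// ltW.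
rewrite [leRHS]mulrAC ler_pdivlMr ?exprn_gt0//.
have : C * e * (eta * h) ^+ 2 <= C * e * (C ^+ 2 * (C * e)).
  by rewrite ler_wpM2l ?mulr_ge0.
lra.
Qed.

(** The sum of [E m j] over the dyadic intervals of levels [n + 1] to [n + r]
that are contained in the interval from [a / 2 ^ (n + r)] to
[b / 2 ^ (n + r)].  Passing to the next coarser level rounds both ends
inward. *)
Fixpoint omega {R : realType} (E : nat -> nat -> R) (n r a b : nat) : R :=
  if r is r'.+1 then
    \sum_(a <= j < b) E (n + r)%N j + omega E n r' (uphalf a) b./2
  else 0.

Lemma omega_ge0 (R : realType) (E : nat -> nat -> R) (n r a b : nat) :
  (forall m j, 0 <= E m j) -> 0 <= omega E n r a b.
Proof.
move=> E0; elim: r a b => //= r IH a b.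
by rewrite addr_ge0// sumr_ge0.
Qed.

(** A dyadic interval lies in at most one of two intervals that do not
overlap; the rounding keeps them so, as [b./2 <= uphalf b']. *)
Lemma omega_superadd (R : realType) (E : nat -> nat -> R) (n r a b b' c : nat) :
  (forall m j, 0 <= E m j) -> (a <= b')%N -> (b <= c)%N -> (b <= b')%N ->
  omega E n r a b + omega E n r b' c <= omega E n r a c.
Proof.
move=> E0; elim: r a b b' c => [|r IH] a b b' c ab' bc bb' /=; first by rewrite addr0.
suff : \sum_(a <= j < b) E (n + r.+1)%N j + \sum_(b' <= j < c) E (n + r.+1)%N j
    <= \sum_(a <= j < c) E (n + r.+1)%N j.
  have := IH (uphalf a) b./2 (uphalf b') c./2.
  move=> IH1 le1; have := IH1 ltac:(lia) ltac:(lia) ltac:(lia); lra.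
have sum_sub (u v : nat) : (a <= u)%N -> (v <= c)%N ->
    \sum_(u <= j < v) E (n + r.+1)%N j <= \sum_(a <= j < c) E (n + r.+1)%N j.
  move=> au vc; have [vu|uv] := leqP v u; first by rewrite big_geq// sumr_ge0.
  rewrite [leRHS](big_cat_nat (n := u))//=; last by lia.
  rewrite [X in _ + X](big_cat_nat (n := v))//=; last by lia.
  by rewrite addrCA lerDl addr_ge0// sumr_ge0.
have [ba|ab] := leqP b a; first by rewrite big_geq// add0r sum_sub.
have [cb'|b'c] := leqP c b'; first by rewrite addrC big_geq// add0r sum_sub.
rewrite [leRHS](big_cat_nat (n := b))//=; last by lia.
rewrite lerD2l (big_cat_nat (m := b) (n := b'))//=; last by lia.
by rewrite lerDr sumr_ge0.
Qed.

Lemma omega_total (R : realType) (E : nat -> nat -> R) (n r a b : nat) :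
  (forall m j, 0 <= E m j) -> (b <= 2 ^ (n + r))%N ->
  omega E n r a b <= \sum_(n.+1 <= m < (n + r).+1) \sum_(0 <= j < 2 ^ m) E m j.
Proof.
move=> E0; elim: r a b => [|r IH] a b br /=.
  by rewrite addn0 big_geq.
rewrite (@big_nat_recr _ _ _ (n + r.+1)%N)/=; last by lia.
rewrite addrC lerD//; first last.
  by rewrite addnS; apply: IH; rewrite addnS expnS in br; lia.
have [ba|ab] := leqP b a; first by rewrite big_geq// sumr_ge0.
rewrite [leRHS](big_cat_nat (n := b))//=.
rewrite [X in X + _](big_cat_nat (n := a))//= ; last by lia.
by rewrite addrAC lerDr addr_ge0// sumr_ge0.
Qed.

(** * The area between a dyadic polygon and its chords *)

(** [G m j] stands for the point of parameter [j / 2 ^ m] of a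
[1/2]-Hölder curve with constant [C], and [E m j] for a bound of the squared
diameter of the three points of parameters [j / 2 ^ m],
[(2 * j + 1) / 2 ^ m.+1] and [(j + 1) / 2 ^ m]. *)
Record dyadic_system (R : realType) (C : R) (G : nat -> nat -> R * R)
    (E : nat -> nat -> R) : Prop := DyadicSystem {
  dyadic_C_ge0 : 0 <= C ;
  dyadic_E_ge0 : forall m j, 0 <= E m j ;
  dyadic_refine : forall m j, G m.+1 (2 * j)%N = G m j ;
  dyadic_holder : forall m a b, (a <= b <= 2 ^ m)%N ->
    enorm (G m b - G m a) ^+ 2 <= C ^+ 2 * ((b - a)%:R / 2 ^+ m) ;
  dyadic_chord : forall m j, (j < 2 ^ m)%N ->
    enorm (G m j.+1 - G m j) ^+ 2 <= E m j ;
  dyadic_mid : forall m j, (j < 2 ^ m)%N ->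
    enorm (G m.+1 (2 * j).+1 - G m j) ^+ 2 <= E m j }.

(** Here [p ^+ 2] and [h ^+ 2] are the Hölder sizes of the two sides. *)
Lemma cross_absorb (R : realType) (C eta h p : R) (u v : R * R) :
  0 <= C -> 0 < eta -> 0 <= h -> 0 <= p ->
  enorm u ^+ 2 <= (C * p ^+ 2) ^+ 2 -> enorm v ^+ 2 <= (C * h ^+ 2) ^+ 2 ->
  `|cross u v| <= C ^+ 4 / eta ^+ 2 * enorm u ^+ 2 + eta * h ^+ 3 * p.
Proof.
move=> C0 eta0 h0 p0.
rewrite !ler_sqr ?nnegrE ?enorm_ge0 ?mulr_ge0 ?exprn_ge0// => uCp vCh.
apply: le_trans (cross_enorm _ _) _; rewrite mulrC.
apply: le_trans (absorb C0 eta0 (enorm_ge0 _) h0 p0 uCp).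
by rewrite ler_wpM2r ?enorm_ge0.
Qed.

(** Induction on the number of levels, by [fan_halving].  As [h ^+ 4] bounds
the length of the interval, each side of an end triangle is at most [C * h ^+ 2];
its short side is at most [C * (q ^+ m) ^+ 2] at level [m], because
[q ^+ 4 = 1/2].  By [cross_absorb] the end triangles cost a multiple of
[E m j] and [2 * eta * h ^+ 3 * q ^+ m], a geometric series in [m] whose partial
sums are kept in the form [h - q ^+ m.+1].  The sum added on the left pays for
the triangles over the edges of the coarser level in the next step. *)
Lemma fan_bound (R : realType) (C eta q c : R) (G : nat -> nat -> R * R)
    (E : nat -> nat -> R) (n r a b : nat) (h : R) :
  dyadic_system C G E -> 0 < eta -> 0 < q < 1 -> q ^+ 4 = 2^-1 ->
  2 * eta <= c * (1 - q) ->
  (a <= b <= 2 ^ (n + r))%N -> (b - a < 2 ^ r)%N ->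
  q ^+ (n + r).+1 <= h -> (b - a)%:R <= 2 ^+ (n + r) * h ^+ 4 ->
  `|fan (G (n + r)%N) a b| + \sum_(a <= j < b) E (n + r)%N j
    <= (2 * (C ^+ 4 / eta ^+ 2) + 1) * omega E n r a b
       + c * h ^+ 3 * (h - q ^+ (n + r).+1).
Proof.
move=> [C0 E0 GG Ghol Gchord Gmid] eta0 /andP[q0 q1] q4 ceta.
have c0 : 0 <= c.
  by rewrite leNgt; apply/negP => ?; nra.
set K := C ^+ 4 / eta ^+ 2.
have K0 : 0 <= K by rewrite divr_ge0 ?exprn_ge0// ltW.
elim: r a b => [|r IH] a b /andP[ab b2] bar qh bah.
  have {}ab : a = b by move: bar; rewrite expn0; nlia.
  rewrite ab fan_short; last nlia.
  rewrite big_geq// normr0 addr0 mulr0 add0r.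
  have h0 : 0 <= h by apply: le_trans qh; rewrite exprn_ge0// ltW.
  by rewrite !mulr_ge0 ?exprn_ge0 ?subr_ge0.
have h0 : 0 <= h by apply: le_trans qh; rewrite exprn_ge0// ltW.
set N := (n + r.+1)%N in qh bah b2 *.
set top := \sum_(a <= j < b) E N j.
have top0 : 0 <= top by rewrite sumr_ge0.
have om0 : 0 <= omega E n r (uphalf a) b./2 by exact: omega_ge0.
rewrite /= -/N -/top.
have [short|long] := leqP b a.+1.
  rewrite fan_short; last nlia.
  have : 0 <= c * h ^+ 3 * (h - q ^+ N.+1).
    by rewrite !mulr_ge0 ?exprn_ge0 ?subr_ge0.
  have : 0 <= K * (top + omega E n r (uphalf a) b./2) by rewrite mulr_ge0 ?addr_ge0.
  rewrite normr0; lra.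
have NE : N = (n + r).+1 by rewrite /N addnS.
have q_pow m : (q ^+ m) ^+ 4 = (2 ^+ m)^-1.
  by rewrite -exprM mulnC exprM q4 exprVn.
have qNh : q ^+ N <= h.
  rewrite -(ler_pXn2r (n := 4)) ?nnegrE ?exprn_ge0//; last exact: ltW.
  rewrite q_pow -div1r ler_pdivrMr ?exprn_gt0// mulrC; apply: le_trans bah.
  by rewrite ler1n; nlia.
set x := uphalf a in om0 *; set y := b./2 in om0 *.
have NE' : (n + r)%N.+1 = N by rewrite NE.
have Fx : G N (2 * x)%N = G (n + r)%N x by rewrite NE GG.
have Fy : G N (2 * y)%N = G (n + r)%N y by rewrite NE GG.
have p2N : (2 ^ N = 2 * 2 ^ (n + r))%N by rewrite NE expnS.
have p2r : (2 ^ r.+1 = 2 * 2 ^ r)%N by rewrite expnS.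
(* The ends of the polygon are single edges of the finer level. *)
have endp u v : (a <= u)%N -> (u <= v <= u.+1)%N -> (v <= b)%N ->
    enorm (G N v - G N u) ^+ 2 <= top /\
    enorm (G N v - G N u) ^+ 2 <= (C * (q ^+ N) ^+ 2) ^+ 2.
  move=> au uv vb; split; last first.
    apply: le_trans (Ghol _ _ _ _) _; first by nlia.
    rewrite exprMn -(exprM _ 2 2) q_pow ler_wpM2l ?sqr_ge0// ler_pdivrMr ?exprn_gt0//.
    by rewrite mulVf ?expf_neq0// (ler_nat _ _ 1); nlia.
  have [->|uv1] := eqVneq v u.
    by rewrite subrr /enorm /= expr0n /= addr0 sqrtr0 expr0n.
  have -> : v = u.+1 by nlia.
  apply: le_trans (Gchord _ _ _) _; first by nlia.
  rewrite /top (big_cat_nat (n := u))//=; last by nlia.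
  rewrite [X in _ + X](big_cat_nat (n := u.+1))//=; last by nlia.
  by rewrite big_nat1 addrCA lerDl addr_ge0// sumr_ge0.
have side u v : (a <= u <= v)%N -> (v <= b)%N ->
    enorm (G N v - G N u) ^+ 2 <= (C * h ^+ 2) ^+ 2.
  move=> /andP[au uv] vb; apply: le_trans (Ghol _ _ _ _) _; first by nlia.
  rewrite exprMn -exprM ler_wpM2l ?sqr_ge0// ler_pdivrMr ?exprn_gt0// mulrC.
  by apply: le_trans bah; rewrite ler_nat; nlia.
have end1 : `|cross (G (n + r)%N x - G N a) (G N b - G (n + r)%N x)|
    <= K * top + eta * h ^+ 3 * q ^+ N.
  have [e1 e2] := endp a (2 * x)%N ltac:(nlia) ltac:(nlia) ltac:(nlia).
  rewrite -Fx; apply: le_trans (cross_absorb C0 eta0 h0 _ e2 _) _.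
  - by rewrite exprn_ge0// ltW.
  - by apply: side; nlia.
  - by rewrite lerD2r ler_wpM2l.
have end2 : `|cross (G (n + r)%N y - G (n + r)%N x) (G N b - G (n + r)%N y)|
    <= K * top + eta * h ^+ 3 * q ^+ N.
  have [e1 e2] := endp (2 * y)%N b ltac:(nlia) ltac:(nlia) ltac:(nlia).
  rewrite -Fx -Fy -normrN (_ : - cross _ _ =
    cross (G N b - G N (2 * y)%N) (G N (2 * y)%N - G N (2 * x)%N)); last first.
    by rewrite /cross/=; ring.
  apply: le_trans (cross_absorb C0 eta0 h0 _ e2 _) _.
  - by rewrite exprn_ge0// ltW.
  - by apply: side; nlia.
  - by rewrite lerD2r ler_wpM2l.
have mids : `|\sum_(x <= j < y) cross (G N (2 * j).+1 - G (n + r)%N j)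
      (G (n + r)%N j.+1 - G (n + r)%N j)| <= \sum_(x <= j < y) E (n + r)%N j.
  apply: le_trans (ler_norm_sum _ _ _) _.
  rewrite big_nat [leRHS]big_nat; apply: ler_sum => j xjy.
  by rewrite NE; apply: cross_sqr_le; [apply: Gmid|apply: Gchord]; nlia.
have IH' : `|fan (G (n + r)%N) x y| + \sum_(x <= j < y) E (n + r)%N j <=
    (2 * K + 1) * omega E n r x y + c * h ^+ 3 * (h - q ^+ N).
  rewrite -NE'; apply: IH; rewrite ?NE'//; [nlia|nlia|].
  rewrite -(ler_pM2l (x := 2%:R)) ?ltr0n// mulrA -exprS NE'.
  by apply: le_trans bah; rewrite -natrM ler_nat; nlia.
have small_end : 2 * eta * (h ^+ 3 * q ^+ N) <= c * (1 - q) * (h ^+ 3 * q ^+ N).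
  by rewrite ler_wpM2r// mulr_ge0 ?exprn_ge0// ltW.
have GG' j : G N (2 * j)%N = G (n + r)%N j by rewrite NE GG.
rewrite (fan_halving GG')//= -/x -/y (exprS q).
set f0 := fan _ x y in IH' *; set f1 := \sum_(x <= j < y) cross _ _ in mids *.
set f2 := cross _ _ in end1 *; set f3 := cross _ _ in end2 *.
have tri : `|f0 + f1 + f2 + f3| <= `|f0| + `|f1| + `|f2| + `|f3|.
  apply: le_trans (ler_normD _ _) _; rewrite lerD2r.
  by apply: le_trans (ler_normD _ _) _; rewrite lerD2r ler_normD.
lra.
Qed.

Lemma fan_sum (R : realType) (G : nat -> R * R) (p : nat -> nat) (k : nat) :
  {homo p : i j / (i <= j)%N} ->
  \sum_(i < k) fan G (p i) (p i.+1) =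
  \sum_(p 0%N <= j < p k) cross (G j) (G j.+1)
  - \sum_(i < k) cross (G (p i)) (G (p i.+1)).
Proof.
move=> pmono; rewrite sumrB; congr (_ - _).
elim: k => [|k IH]; first by rewrite big_ord0 big_geq.
rewrite big_ord_recr/= IH -big_cat_nat//=; exact: pmono.
Qed.

Lemma omega_sum (R : realType) (E : nat -> nat -> R) (n r : nat)
    (p : nat -> nat) (k : nat) :
  (forall m j, 0 <= E m j) -> {homo p : i j / (i <= j)%N} ->
  \sum_(i < k) omega E n r (p i) (p i.+1) <= omega E n r (p 0%N) (p k).
Proof.
move=> E0 pmono; elim: k => [|k IH]; first by rewrite big_ord0 omega_ge0.
rewrite big_ord_recr/=.
apply: le_trans (omega_superadd n r E0 (pmono _ _ (leq0n k))
  (pmono _ _ (leqnSn k)) (leqnn _)).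
by rewrite lerD2r.
Qed.

Lemma quarter_root (R : realType) : exists2 q : R, 0 < q < 1 & q ^+ 4 = 2^-1.
Proof.
exists (Num.sqrt (Num.sqrt 2^-1)); last first.
  by rewrite (exprM _ 2 2) sqr_sqrtr ?sqrtr_ge0// sqr_sqrtr// invr_ge0.
rewrite !sqrtr_gt0 invr_gt0 ltr0n/=.
rewrite -(ltr_pXn2r (n := 4)) ?nnegrE ?sqrtr_ge0// expr1n.
rewrite (exprM _ 2 2) sqr_sqrtr ?sqrtr_ge0// sqr_sqrtr ?invr_ge0//.
by rewrite invf_lt1 ?ltr1n.
Qed.

(** The constant [K] is chosen before the system of points and the partition,
so that a tail of the series can afterwards be made small compared with [K].
The bounds of [fan_bound] add up: [omega] is superadditive, and the lengths of
the intervals add up to 1. *)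
Lemma polygon_refinement (R : realType) (C eps : R) : 0 < eps ->
  exists2 K : R, 0 <= K & forall (G : nat -> nat -> R * R)
    (E : nat -> nat -> R) (n r k : nat) (p : nat -> nat),
  dyadic_system C G E -> {homo p : i j / (i <= j)%N} ->
  p 0%N = 0%N -> p k = (2 ^ (n + r))%N ->
  (forall i, (i < k)%N -> (p i.+1 - p i < 2 ^ r)%N) ->
  `|\sum_(0 <= j < 2 ^ (n + r)) cross (G (n + r)%N j) (G (n + r)%N j.+1)
    - \sum_(i < k) cross (G (n + r)%N (p i)) (G (n + r)%N (p i.+1))|
  <= K * (\sum_(n.+1 <= m < (n + r).+1) \sum_(0 <= j < 2 ^ m) E m j) + eps.
Proof.
move=> eps0; have [q q01 q4] := quarter_root R; have /andP[q0 q1] := q01.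
(* This is the largest [eta] for which [fan_bound] applies with [c := eps]. *)
pose eta := eps * (1 - q) / 2.
have eta0 : 0 < eta by rewrite !mulr_gt0 ?subr_gt0// invr_gt0.
pose K := 2 * (C ^+ 4 / eta ^+ 2) + 1.
have C4 : 0 <= C ^+ 4 by rewrite (exprM _ 2 2) sqr_ge0.
have K0 : 0 <= K.
  by rewrite addr_ge0// mulr_ge0// divr_ge0// exprn_ge0// ltW.
exists K => // G E n r k p sys pmono p0 pk pstep; have E0 := dyadic_E_ge0 sys.
set N := (n + r)%N in pk *; pose l i : R := (p i.+1 - p i)%:R / 2 ^+ N.
have l_ge0 i : 0 <= l i by rewrite divr_ge0// exprn_ge0.
have fan_le i : (i < k)%N -> `|fan (G N) (p i) (p i.+1)|
    <= K * omega E n r (p i) (p i.+1) + eps * l i.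
  move=> ik; have pi1 : (p i <= p i.+1)%N by exact: pmono.
  have [eqp|neqp] := eqVneq (p i) (p i.+1).
    rewrite fan_short ?eqp ?leqnn ?leqnSn// normr0 addr_ge0//.
      by rewrite mulr_ge0// omega_ge0.
    by rewrite mulr_ge0// ltW.
  (* With [h ^+ 4] equal to the length, the remainder of [fan_bound] is at most
     [eps] times the length. *)
  set h := Num.sqrt (Num.sqrt (l i)).
  have h0 : 0 <= h by exact: sqrtr_ge0.
  have h4 : h ^+ 4 = l i.
    by rewrite (exprM _ 2 2) sqr_sqrtr ?sqrtr_ge0// sqr_sqrtr.
  have qh : q ^+ N.+1 <= h.
    rewrite -(ler_pXn2r (n := 4)) ?nnegrE ?exprn_ge0//; last exact: ltW.
    rewrite h4 -exprM mulnC exprM q4 exprVn exprS /l.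
    rewrite invfM ler_wpM2r ?invr_ge0 ?exprn_ge0//.
    apply: (le_trans (y := 1)); first by rewrite invf_le1 ?ler1n.
    by rewrite ler1n; nlia.
  have := @fan_bound R C eta q eps G E n r (p i) (p i.+1) h sys eta0 q01 q4.
  rewrite -/N -/K => /(_ _ _ _ qh) main.
  have {main} : `|fan (G N) (p i) (p i.+1)| + \sum_(p i <= j < p i.+1) E N j
      <= K * omega E n r (p i) (p i.+1) + eps * h ^+ 3 * (h - q ^+ N.+1).
    apply: main; last 1 first.
    - by rewrite h4 mulrC divfK// expf_neq0.
    - by rewrite /eta; lra.
    - by rewrite pi1/= -pk pmono.
    - exact: pstep.
  have : 0 <= \sum_(p i <= j < p i.+1) E N j by rewrite sumr_ge0.
  have : 0 <= eps * h ^+ 3 * q ^+ N.+1.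
    by rewrite !mulr_ge0 ?exprn_ge0//; apply: ltW.
  rewrite -h4; lra.
have l_sum : \sum_(i < k) l i = 1.
  have sumE m : \sum_(i < m) l i = (p m)%:R / 2 ^+ N.
    elim: m => [|m IH]; first by rewrite big_ord0 p0 mul0r.
    rewrite big_ord_recr/= IH /l -mulrDl -natrD subnKC//; exact: pmono.
  by rewrite sumE pk natrX divff// expf_neq0.
have := fan_sum (G N) k pmono; rewrite p0 pk => <-.
apply: le_trans (ler_norm_sum _ _ _) _.
apply: (le_trans (y := \sum_(i < k)
    (K * omega E n r (p i) (p i.+1) + eps * l i))).
  by apply: ler_sum => i _; exact: fan_le.
rewrite big_split/= -!mulr_sumr l_sum mulr1 lerD2r ler_wpM2l//.
apply: le_trans (omega_sum n r k E0 pmono) _.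
by rewrite p0 pk omega_total.
Qed.

(** * Polar angles and crossings of a ray *)

Lemma periodic_int (U V : zmodType) (f : U -> V) (T : U) (k : int) (u : U) :
  periodic f T -> f (u + T *~ k) = f u.
Proof.
move=> fT; case: k => n; first by rewrite -pmulrn periodicn.
by rewrite NegzE mulrNz -pmulrn -[LHS](periodicn fT n.+1) subrK.
Qed.

Lemma sin_lt0 (R : realType) (x : R) : pi < x < 2 * pi -> sin x < 0.
Proof.
move=> /andP[x1 x2]; rewrite -[x](subrK pi) sinDpi oppr_lt0.
by apply: sin_gt0_pi; lra.
Qed.

(** The number of complete turns made by an angle, that is the sheet of the
universal cover on which it lies when the plane is cut along a ray. *)
Definition turns {R : realType} (x : R) : int := Num.floor (x / (2 * pi)).

Definition rem2pi {R : realType} (x : R) : R := x - (pi *+ 2) *~ turns x.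

Lemma rem2pi_itv (R : realType) (x : R) : 0 <= rem2pi x < 2 * pi.
Proof.
have pi2 : 0 < 2 * pi :> R by rewrite mulr_gt0// pi_gt0.
have := floor_itv (x / (2 * pi)).
rewrite ler_pdivlMr// ltr_pdivrMr// -/(turns x) /rem2pi => /andP[f1 f2].
have -> : pi *+ 2 *~ turns x = (turns x)%:~R * (2 * pi) :> R.
  by rewrite -mulrzl mulr_natl.
by rewrite rmorphD/= in f2; lra.
Qed.

Lemma sin_rem2pi (R : realType) (x y : R) :
  sin (y - (pi *+ 2) *~ turns x) = sin y.
Proof. by rewrite -mulrNz periodic_int//; exact: sinD2pi. Qed.

Lemma cos_rem2pi (R : realType) (x y : R) :
  cos (y - (pi *+ 2) *~ turns x) = cos y.
Proof. by rewrite -mulrNz periodic_int//; exact: cosD2pi. Qed.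

Lemma turns_ltE (R : realType) (x y : R) :
  (turns x < turns y) = (2 * pi <= y - (pi *+ 2) *~ turns x).
Proof.
have pi2 : 0 < 2 * pi :> R by rewrite mulr_gt0// pi_gt0.
rewrite -lezD1 floor_ge_int ler_pdivlMr// rmorphD/= -mulrzl mulr_natl.
by apply/idP/idP; lra.
Qed.

Lemma cos_eq1 (R : realType) (x : R) :
  cos x = 1 -> x = (2 * pi) * (turns x)%:~R.
Proof.
move=> cx; suff r0 : rem2pi x = 0.
  have e : x = pi *+ 2 *~ turns x by apply/eqP; rewrite -subr_eq0 -/(rem2pi x) r0.
  by rewrite {1}e -mulrzl mulrC mulr_natl.
have cr : cos (rem2pi x) = 1 by rewrite cos_rem2pi.
have sr : sin (rem2pi x) = 0 by apply: cos1sin0; rewrite cr normr1.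
have /andP[r0 r2] := rem2pi_itv x; apply/eqP; apply: contrapT => /negP rn0.
have {}r0 : 0 < rem2pi x by rewrite lt_neqAle eq_sym rn0.
have [rpi|rpi|rpi] := ltgtP (rem2pi x) pi.
- have : 0 < sin (rem2pi x) by apply: sin_gt0_pi; lra.
  by rewrite sr ltxx.
- have : sin (rem2pi x) < 0 by apply: sin_lt0; lra.
  by rewrite sr ltxx.
- by move: cr; rewrite rpi cospi; lra.
Qed.

(** The segment from [a] to [b] crosses upward the ray that leaves [z] in the
direction of the first axis.  The inequalities are half-open so that a path through
a vertex on the ray is not counted twice. *)
Definition upcross {R : realType} (z a b : R * R) : bool :=
  (a.2 < z.2) && (z.2 <= b.2) && (0 < cross (a - z) (b - z)).

Definition crossing {R : realType} (z a b : R * R) : R :=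
  (upcross z a b)%:R - (upcross z b a)%:R.

Definition polar {R : realType} (v : R * R) (phi : R) : Prop :=
  (cos phi, sin phi) = (v.1 / enorm v, v.2 / enorm v).

Lemma polarE (R : realType) (v : R * R) (phi : R) : v != 0 -> polar v phi ->
  v = (enorm v * cos phi, enorm v * sin phi).
Proof.
move=> v0 [-> ->]; have : enorm v != 0.
  by apply: contra v0 => /eqP/enorm_eq0 ->.
by case: v v0 => x y _ e0 /=; rewrite ![enorm _ * _]mulrC !divfK.
Qed.

(** The polar angle seen from [z] passes a multiple of [2 * pi] exactly when
the ray is crossed.  After subtracting the complete turns of [alpha], this is a
comparison of the signs of three sines. *)
Lemma upcross_turns (R : realType) (z a b : R * R) (alpha beta : R) :
  a != z -> b != z -> polar (a - z) alpha -> polar (b - z) beta ->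
  `|beta - alpha| < pi -> upcross z a b = (turns alpha < turns beta).
Proof.
move=> az bz /polarE pa /polarE pb; rewrite ltr_distlC => /andP[ab ba].
move: pa pb; rewrite !subr_eq0 => /(_ az) pa /(_ bz) pb.
have epos v : v != z -> 0 < enorm (v - z).
  move=> vz; rewrite lt_neqAle enorm_ge0 andbT eq_sym.
  by apply: contra vz => /eqP/enorm_eq0/eqP; rewrite subr_eq0.
have ra := epos _ az; have rb := epos _ bz.
rewrite /upcross -subr_lt0 -[z.2 <= _]subr_ge0 -![_.2 - z.2]/((_ - z).2) pa pb.
move: (enorm _) ra (enorm _) rb => {pa pb epos} s s0 t t0; rewrite /cross /=.
rewrite (_ : _ - _ = s * t * sin (beta - alpha)); last by rewrite sinB; ring.
rewrite pmulr_rlt0// pmulr_rge0// (pmulr_rgt0 _ (mulr_gt0 s0 t0)) turns_ltE.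
rewrite -(sin_rem2pi alpha alpha) -(sin_rem2pi alpha beta) -/(rem2pi alpha).
(* Both angles are reduced by the complete turns of [alpha]. *)
set b0 := beta - _ *~ _.
have -> : beta - alpha = b0 - rem2pi alpha by rewrite /b0 /rem2pi; lra.
have {ab ba} : b0 - pi < rem2pi alpha < b0 + pi by rewrite /b0 /rem2pi; lra.
have := rem2pi_itv alpha; move: (rem2pi _) b0 => {alpha beta az bz} x y.
move=> /andP[x0 x2] /andP[yx xy].
have [xpi|xpi] := leP x pi.
  rewrite [sin x < 0]ltNge sin_ge0_pi ?x0//=.
  by apply/esym/negbTE; rewrite -ltNge; lra.
rewrite sin_lt0 ?xpi//=.
have [y2|y2] := leP (2 * pi) y.
  have -> : 0 < sin (y - x) by apply: sin_gt0_pi; lra.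
  rewrite andbT -[y](subrK (pi *+ 2)) sinD2pi sin_ge0_pi// mulr2n; lra.
have [ypi|ypi] := leP y pi.
  rewrite -[y - x]opprB sinN oppr_gt0 ltNge (_ : 0 <= sin (x - y)) ?andbF//.
  apply: sin_ge0_pi; lra.
by rewrite leNgt sin_lt0// ypi.
Qed.

(** The two numbers of turns differ by at most one, since the angles differ
by less than [pi]. *)
Lemma crossing_turns (R : realType) (z a b : R * R) (alpha beta : R) :
  a != z -> b != z -> polar (a - z) alpha -> polar (b - z) beta ->
  `|beta - alpha| < pi ->
  crossing z a b = (turns beta)%:~R - (turns alpha)%:~R.
Proof.
move=> az bz pa pb ab; have ba : `|alpha - beta| < pi by rewrite distrC.
rewrite /crossing (upcross_turns az bz pa pb ab) (upcross_turns bz az pb pa ba).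
suff step x y : `|y - x| < pi :> R -> turns y <= turns x + 1.
  have := step _ _ ab; have := step _ _ ba.
  have [lt|lt|->] := ltgtP (turns alpha) (turns beta) => s1 s2.
  - have -> : turns beta = turns alpha + 1 by lia.
    by rewrite rmorphD/=; lra.
  - have -> : turns alpha = turns beta + 1 by lia.
    by rewrite rmorphD/=; lra.
  - by rewrite !subrr.
rewrite ltr_distlC => /andP[xy _].
rewrite -ltzD1 floor_lt_int ltr_pdivrMr ?mulr_gt0 ?pi_gt0//.
have /andP[_] := rem2pi_itv x; rewrite /rem2pi -mulrzl -mulr_natl.
have -> : (turns x + 1 + 1)%:~R = (turns x)%:~R + 1 + 1 :> R by rewrite !rmorphD.
have := @pi_gt0 R; move: (_%:~R) => s; lra.
Qed.

(** * Continuous choice of the polar angle along a curve *)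

Definition dot {R : realType} (u v : R * R) : R := u.1 * v.1 + u.2 * v.2.

Lemma dot_gt0 (R : realType) (u v : R * R) :
  enorm (v - u) < enorm u -> 0 < dot u v.
Proof.
move=> vu; have : enorm (v - u) ^+ 2 < enorm u ^+ 2.
  by rewrite ltr_sqr ?nnegrE ?enorm_ge0.
have : 0 <= v.1 ^+ 2 by exact: sqr_ge0.
have : 0 <= v.2 ^+ 2 by exact: sqr_ge0.
by rewrite !enorm_sqr /dot/=; lra.
Qed.

Lemma polar_exists (R : realType) (v : R * R) :
  v != 0 -> exists phi, polar v phi.
Proof.
move=> v0; have e0 : 0 < enorm v.
  by rewrite lt_neqAle enorm_ge0 eq_sym andbT; apply: contra v0 => /eqP/enorm_eq0 ->.
have x1 : -1 <= v.1 / enorm v <= 1.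
  by rewrite -ler_norml normrM normfV (ger0_norm (ltW e0)) ler_pdivrMr// mul1r enorm_fst.
have s : sin (acos (v.1 / enorm v)) = `|v.2| / enorm v.
  rewrite sin_acos// -[RHS]ger0_norm ?divr_ge0// ?ltW// -sqrtr_sqr; congr Num.sqrt.
  rewrite !exprMn real_normK ?num_real// !exprVn enorm_sqr.
  have : v.1 ^+ 2 + v.2 ^+ 2 != 0 by rewrite -enorm_sqr expf_neq0// gt_eqF.
  by move=> ne; field.
have [v2|v2] := leP 0 v.2.
  by exists (acos (v.1 / enorm v)); rewrite /polar acosK// s ger0_norm.
exists (- acos (v.1 / enorm v)).
by rewrite /polar cosN sinN acosK// s ltr0_norm// mulNr opprK.
Qed.

(** When [v] lies in the open half-plane around [u], the angle from [u] to
[v] is the arctangent of [cross u v / dot u v]. *)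
Lemma polar_step (R : realType) (u v : R * R) (phi : R) :
  u != 0 -> 0 < dot u v -> polar u phi ->
  polar v (phi + atan (cross u v / dot u v)).
Proof.
move=> u0 duv [cphi sphi]; set d := dot u v; set c := cross u v.
have enz (w : R * R) : w != 0 -> 0 < enorm w.
  move=> w0; rewrite lt_neqAle enorm_ge0 eq_sym andbT.
  by apply: contra w0 => /eqP/enorm_eq0 ->.
have v0 : v != 0 by apply: contraTneq duv => ->; rewrite /dot/= !mulr0 addr0 ltxx.
have ru := enz _ u0; have rv := enz _ v0.
have d0 : d != 0 by rewrite gt_eqF.
have sq : Num.sqrt (1 + (c / d) ^+ 2) = enorm u * enorm v / d.
  have -> : 1 + (c / d) ^+ 2 = (enorm u * enorm v / d) ^+ 2.
    rewrite !exprMn exprVn (_ : enorm u ^+ 2 * enorm v ^+ 2 = c ^+ 2 + d ^+ 2).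
      by field.
    by rewrite !enorm_sqr /c /d /cross /dot; ring.
  by rewrite sqrtr_sqr ger0_norm// divr_ge0 ?ltW// mulr_gt0.
have ca : cos (atan (c / d)) = d / (enorm u * enorm v).
  by rewrite cos_atan sq invf_div.
have sa : sin (atan (c / d)) = c / (enorm u * enorm v).
  have := atanK (c / d); rewrite /tan => /(congr1 (fun x => x * cos (atan (c / d)))).
  rewrite divfK; last by rewrite ca mulf_neq0// invr_eq0 mulf_neq0// gt_eqF.
  by rewrite ca => ->; field; rewrite d0 !gt_eqF.
have eu2 : enorm u ^+ 2 != 0 by rewrite expf_neq0// gt_eqF.
have ev : enorm v != 0 by rewrite gt_eqF.
have eu : enorm u != 0 by rewrite gt_eqF.
rewrite /polar cosD sinD cphi sphi ca sa; congr (_, _).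
  transitivity (v.1 * enorm u ^+ 2 / (enorm u ^+ 2 * enorm v)).
    by rewrite {1}enorm_sqr /c /d /cross /dot; field; rewrite ev eu.
  by field; rewrite ev eu.
transitivity (v.2 * enorm u ^+ 2 / (enorm u ^+ 2 * enorm v)).
  by rewrite {1}enorm_sqr /c /d /cross /dot; field; rewrite ev eu.
by field; rewrite ev eu.
Qed.

(** The interval is cut into [N] pieces so short that seen from [z] each piece
of curve stays in a half-plane.  The [i]-th term is the angle swept by the
curve on the [i]-th piece up to time [t]: clamping [t] to the piece makes it
vanish before the piece and stay constant after it, so that the whole sum is
continuous without any gluing. *)
Lemma angle_lift (R : realType) (g : R -> R * R) (z : R * R) (r : R) (N : nat) :
  continuous (fst \o g) -> continuous (snd \o g) ->
  (0 < N)%N -> (forall t, r <= enorm (g t - z)) -> 0 < r ->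
  (forall s t, `|s - t| <= N%:R^-1 -> enorm (g s - g t) < r) ->
  exists2 theta : R -> R, continuous theta &
    forall t, t \in `[0, 1] -> polar (g t - z) (theta t).
Proof.
move=> c1 c2 N0 rg r0 small.
have gz t : g t - z != 0.
  by apply: contraTneq (rg t) => ->; rewrite /enorm/= expr0n/= addr0 sqrtr0 -ltNge.
have [phi0 pol0] := polar_exists (gz 0).
pose tt (i : nat) : R := i%:R / N%:R.
have N0' : 0 < N%:R :> R by rewrite ltr0n.
have ttS i : tt i.+1 = tt i + N%:R^-1 by rewrite /tt -addn1 natrD mulrDl mul1r.
have tt_le i : tt i <= tt i.+1 by rewrite ttS lerDl invr_ge0 ltW.
pose cl (i : nat) (t : R) := Num.min (Num.max t (tt i)) (tt i.+1).
have cl_itv i t : tt i <= cl i t <= tt i.+1.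
  by rewrite /cl le_min ge_min lexx le_max lexx !orbT tt_le.
have dpos i t : 0 < dot (g (tt i) - z) (g (cl i t) - z).
  apply: dot_gt0; rewrite opprB addrA subrK.
  apply: lt_le_trans (rg _); apply: small.
  by have := cl_itv i t; rewrite ttS ler_norml => /andP[? ?]; lra.
pose term i t := atan (cross (g (tt i) - z) (g (cl i t) - z)
                       / dot (g (tt i) - z) (g (cl i t) - z)).
have cterm i : continuous (term i).
  move=> t.
  apply: (@continuous_comp _ _ _ (fun t => cross (g (tt i) - z) (g (cl i t) - z)
     / dot (g (tt i) - z) (g (cl i t) - z)) atan); last exact: continuous_atan.
  have ccl : {for t, continuous (cl i)}.
    apply: (@continuous_min _ _ (fun t => Num.max t (tt i)) (fun=> tt i.+1) t).
      apply: (@continuous_max _ _ id (fun=> tt i) t); first exact: cvg_id.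
      exact: cvg_cst.
    exact: cvg_cst.
  have f1 : (g (cl i s)).1 @[s --> t] --> (g (cl i t)).1.
    exact: (continuous_comp ccl (c1 (cl i t))).
  have f2 : (g (cl i s)).2 @[s --> t] --> (g (cl i t)).2.
    exact: (continuous_comp ccl (c2 (cl i t))).
  apply: cvgM.
    apply: cvgB; (apply: cvgM; first exact: cvg_cst); apply: cvgB => //; exact: cvg_cst.
  apply: cvgV; first by rewrite gt_eqF.
  by apply: cvgD; (apply: cvgM; first exact: cvg_cst); apply: cvgB => //; exact: cvg_cst.
exists (fun t => phi0 + \sum_(i < N) term i t).
  have csum := @continuous_big R 'I_N +%R 0 xpredT (@add_continuous R) R
    (index_enum 'I_N) (fun i : 'I_N => term i) (fun i _ => cterm i).
  by move=> t; apply: cvgD; [exact: cvg_cst|exact: csum].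
suff main k t : 0 <= t -> polar (g (Num.min t (tt k)) - z) (phi0 + \sum_(i < k) term i t).
  move=> t; rewrite in_itv/= => /andP[t0 t1].
  have := main N t t0; rewrite (_ : Num.min t (tt N) = t)//.
  by apply/min_idPl; rewrite /tt divff ?gt_eqF.
move=> t0; elim: k => [|k IH].
  by rewrite big_ord0 addr0 /tt mul0r (min_idPr _).
rewrite big_ord_recr/= addrA.
have [tk|kt] := leP t (tt k).
  rewrite (min_idPl (le_trans tk (tt_le k))).
  move: IH; rewrite (min_idPl tk) => IH.
  suff -> : term k t = 0 by rewrite addr0.
  rewrite /term /cl (max_idPr tk) (min_idPl (tt_le k)).
  by rewrite cross_self mul0r atan0.
move: IH; rewrite (min_idPr (ltW kt)) => IH.
have -> : Num.min t (tt k.+1) = cl k t by rewrite /cl (max_idPl (ltW kt)).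
exact: polar_step.
Qed.

(** * Winding numbers as numbers of crossings *)

Definition holder_sqr {R : realType} (C : R) (g : R -> R * R) : Prop :=
  forall s t : R, s \in `[0, 1] -> t \in `[0, 1] ->
    enorm (g s - g t) ^+ 2 <= C ^+ 2 * `|s - t|.

Lemma holder_curve_sqr (R : realType) (g : R -> R * R) :
  holder_curve 2^-1 g -> exists2 C, 0 <= C & holder_sqr C g.
Proof.
case=> C hC; exists `|C| => // s t s01 t01.
have := hC s t s01 t01; rewrite powR12_sqrt// => h.
have {}h : enorm (g s - g t) <= `|C| * Num.sqrt `|s - t|.
  by apply: le_trans h _; rewrite ler_wpM2r ?sqrtr_ge0 ?ler_norm.
by rewrite -(@sqr_sqrtr _ `|s - t|)// -exprMn ler_sqr ?nnegrE ?enorm_ge0.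
Qed.

(** Composing with [clamp] extends a curve on [[0, 1]] to the whole line. *)
Definition clamp {R : realType} (t : R) : R := Num.min (Num.max t 0) 1.

Lemma clamp_itv (R : realType) (t : R) : clamp t \in `[0, 1].
Proof. by rewrite in_itv/= /clamp le_min ge_min lexx le_max lexx !orbT ler01. Qed.

Lemma clamp_id (R : realType) (t : R) : t \in `[0, 1] -> clamp t = t.
Proof.
by rewrite in_itv/= => /andP[t0 t1]; rewrite /clamp (max_idPl t0) (min_idPl t1).
Qed.

Lemma clamp_dist (R : realType) (s t : R) : `|clamp s - clamp t| <= `|s - t|.
Proof.
have lip (f : R -> R) : (forall x y, x <= y -> 0 <= f y - f x <= y - x) ->
    forall x y, `|f x - f y| <= `|x - y|.
  move=> fxy x y; wlog xy : x y / x <= y => [hw|].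
    by have [/hw//|/ltW/hw] := leP x y; rewrite distrC (distrC y).
  have /andP[f0 f1] := fxy x y xy.
  by rewrite distrC (distrC x) !ger0_norm// subr_ge0.
apply: lip => x y xy; rewrite /clamp.
by case: (leP x 0) => ?; case: (leP y 0) => ?; case: (leP 0 (1 : R)) => ?;
  case: (leP x 1) => ?; case: (leP y 1) => ?; lra.
Qed.

Lemma holder_continuous (R : realType) (C : R) (f : R -> R) :
  (forall s t, `|f s - f t| ^+ 2 <= C * `|s - t|) -> continuous f.
Proof.
move=> hf t; apply/cvgrPdist_lt => eps eps0.
have C1 : 0 < `|C| + 1 by rewrite ltr_wpDl.
near=> s; rewrite -ltr_sqr ?nnegrE//; last exact: ltW.
apply: le_lt_trans (hf _ _) _.
apply: (le_lt_trans (y := (`|C| + 1) * `|t - s|)).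
  rewrite ler_wpM2r//; apply: le_trans (ler_norm C) _; lra.
rewrite mulrC -ltr_pdivlMr//.
near: s; apply: cvgr_dist_lt; first exact: cvg_id.
by rewrite divr_gt0// exprn_gt0.
Unshelve. all: by end_near. Qed.

Lemma holder_clamp (R : realType) (C : R) (g : R -> R * R) (s t : R) :
  holder_sqr C g ->
  enorm (g (clamp s) - g (clamp t)) ^+ 2 <= C ^+ 2 * `|s - t|.
Proof.
move=> hg; apply: le_trans (hg _ _ (clamp_itv s) (clamp_itv t)) _.
by rewrite ler_wpM2l ?sqr_ge0// clamp_dist.
Qed.

Lemma continuous_clamp_fst (R : realType) (C : R) (g : R -> R * R) :
  holder_sqr C g -> continuous (fst \o (g \o clamp)).
Proof.
move=> hg; apply: (@holder_continuous _ (C ^+ 2)) => s t.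
apply: le_trans (holder_clamp s t hg).
by rewrite ler_sqr ?nnegrE ?enorm_ge0//; exact: (enorm_fst (_ - _)).
Qed.

Lemma continuous_clamp_snd (R : realType) (C : R) (g : R -> R * R) :
  holder_sqr C g -> continuous (snd \o (g \o clamp)).
Proof.
move=> hg; apply: (@holder_continuous _ (C ^+ 2)) => s t.
apply: le_trans (holder_clamp s t hg).
by rewrite ler_sqr ?nnegrE ?enorm_ge0//; exact: (enorm_snd (_ - _)).
Qed.

(** The distance from [z] attains its minimum on the compact interval. *)
Lemma distance_to_curve (R : realType) (C : R) (g : R -> R * R) (z : R * R) :
  holder_sqr C g -> ~ curve_image g z ->
  exists2 r, 0 < r & forall t, t \in `[0, 1] -> r <= enorm (g t - z).
Proof.
move=> hg gz.
pose f t := ((g (clamp t)).1 - z.1) ^+ 2 + ((g (clamp t)).2 - z.2) ^+ 2.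
have cf : continuous f.
  move=> t; apply: cvgD; rewrite /=; apply: cvgM; apply: cvgB; try exact: cvg_cst.
  - exact: (continuous_clamp_fst hg).
  - exact: (continuous_clamp_fst hg).
  - exact: (continuous_clamp_snd hg).
  - exact: (continuous_clamp_snd hg).
have [c c01 cmin] := @EVT_min R f 0 1 ler01 (continuous_subspaceT cf).
have fE t : t \in `[0, 1] -> Num.sqrt (f t) = enorm (g t - z).
  by move=> t01; rewrite /f clamp_id.
exists (Num.sqrt (f c)); last first.
  by move=> t t01; rewrite -fE// ler_wsqrtr// cmin.
rewrite fE// lt_neqAle enorm_ge0 andbT eq_sym; apply/eqP => /enorm_eq0/eqP.
by rewrite subr_eq0 => /eqP gc; apply: gz; exists c.
Qed.

(** Between [s] and [t] the curve stays in the half-plane around [g s] seen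
from [z], so the cosine of [theta u - theta s] never vanishes; by the
intermediate value theorem [theta u - theta s] cannot reach [pi / 2]. *)
Lemma angle_step (R : realType) (g : R -> R * R) (z : R * R) (theta : R -> R)
    (s t : R) :
  angle_function g z theta -> s \in `[0, 1] -> t \in `[0, 1] -> s <= t ->
  (forall u, u \in `[s, t] -> enorm (g u - g s) < enorm (g s - z)) ->
  `|theta t - theta s| < pi.
Proof.
move=> [ctheta ptheta] s01 t01 st near_s.
have sub u : u \in `[s, t] -> u \in `[0, 1].
  by move: s01 t01; rewrite !in_itv/= => /andP[? ?] /andP[? ?] /andP[? ?]; lra.
have cpos u : u \in `[s, t] -> cos (theta u - theta s) != 0.
  move=> ust; have [cs ss] : polar (g s - z) (theta s) := ptheta s s01.
  have [cu su] : polar (g u - z) (theta u) := ptheta u (sub u ust).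
  have d : 0 < dot (g s - z) (g u - z).
    by apply: dot_gt0; rewrite opprB addrA subrK near_s.
  have eu w : dot (g s - z) w != 0 \/ dot w (g u - z) != 0 -> enorm w != 0.
    by move=> [] ; apply: contra => /eqP/enorm_eq0 ->;
      rewrite /dot/= ?mulr0 ?mul0r addr0.
  have e1 : enorm (g s - z) != 0 by apply: eu; right; rewrite gt_eqF.
  have e2 : enorm (g u - z) != 0 by apply: eu; left; rewrite gt_eqF.
  rewrite cosB cs ss cu su.
  rewrite (_ : _ + _ = dot (g s - z) (g u - z) / (enorm (g s - z) * enorm (g u - z))).
    by rewrite mulf_neq0 ?invr_eq0 ?mulf_neq0// gt_eqF.
  by rewrite /dot; field; rewrite e1 e2.
have cst : {within `[s, t], continuous theta}.
  by apply: continuous_subspaceW ctheta => u /= ust; exact: sub.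
have pi0 := pi_gt0 R.
rewrite ltNge; apply/negP => large.
have : exists2 u, u \in `[s, t] & `|theta u - theta s| = pi / 2.
  move: large; rewrite ler_normr => /orP[]large.
    have [|u ust uE] := @IVT R theta s t (theta s + pi / 2) st cst.
      by rewrite ge_min le_max; apply/andP; split; apply/orP; [left|right]; lra.
    by exists u => //; rewrite uE addrC addKr ger0_norm//; lra.
  have [|u ust uE] := @IVT R theta s t (theta s - pi / 2) st cst.
    by rewrite ge_min le_max; apply/andP; split; apply/orP; [right|left]; lra.
  by exists u => //; rewrite uE addrC addKr normrN ger0_norm//; lra.
case=> u /cpos; rewrite -(cos_norm (theta u - _)) => /[swap] ->.
by rewrite cos_pihalf eqxx.
Qed.

Definition node {R : realType} (g : R -> R * R) (m j : nat) : R * R :=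
  g (j%:R / 2 ^+ m).

Definition polygon_wind {R : realType} (g : R -> R * R) (m : nat) (z : R * R) : R :=
  \sum_(0 <= j < 2 ^ m) crossing z (node g m j) (node g m j.+1).

Lemma dyadic_itv (R : realType) (m j : nat) :
  (j <= 2 ^ m)%N -> (j%:R / 2 ^+ m : R) \in `[0, 1].
Proof.
move=> jm; rewrite in_itv/= divr_ge0 ?exprn_ge0//=.
by rewrite ler_pdivrMr ?exprn_gt0// mul1r -natrX ler_nat.
Qed.

Lemma dyadic_step (R : realType) (m j : nat) :
  j.+1%:R / 2 ^+ m = j%:R / 2 ^+ m + (2 ^+ m)^-1 :> R.
Proof. by rewrite -addn1 natrD mulrDl mul1r. Qed.

(** On the short edges of level [m] any angle function moves by less than
[pi], so the crossings telescope to the number of turns of the angle between the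
times 0 and 1.  The curve is closed, so the two angles differ by a multiple of
[2 * pi], and the number of turns is the winding number. *)
Lemma wind_polygon_step (R : realType) (C r : R) (g : R -> R * R) (z : R * R)
    (m : nat) :
  closed_curve g -> holder_sqr C g -> ~ curve_image g z -> 0 < r ->
  (forall t, t \in `[0, 1] -> r <= enorm (g t - z)) ->
  C ^+ 2 / 2 ^+ m < r ^+ 2 ->
  wind g z = polygon_wind g m z.
Proof.
move=> g01 hg gz r0 rg rC.
have near_s s t : s \in `[0, 1] -> t \in `[0, 1] -> `|s - t| <= (2 ^+ m)^-1 ->
    enorm (g s - g t) < r.
  move=> s01 t01 st; rewrite -ltr_sqr ?nnegrE ?enorm_ge0//; last exact: ltW.
  apply: le_lt_trans (hg _ _ s01 t01) _; apply: le_lt_trans rC.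
  by rewrite ler_wpM2l ?sqr_ge0.
have gne t : t \in `[0, 1] -> g t != z.
  by move=> t01; apply/eqP => gtz; apply: gz; exists t.
have value theta : angle_function g z theta ->
    (theta 1 - theta 0) / (2 * pi) = polygon_wind g m z.
  move=> ang; pose th j := theta (j%:R / 2 ^+ m).
  have pth t : t \in `[0, 1] -> polar (g t - z) (theta t) by exact: ang.2.
  have -> : polygon_wind g m z =
      \sum_(0 <= j < 2 ^ m) ((turns (th j.+1))%:~R - (turns (th j))%:~R).
    rewrite /polygon_wind big_nat [RHS]big_nat; apply: eq_bigr => j /andP[_ jm].
    have j01 := dyadic_itv R (ltnW jm); have j101 := dyadic_itv R jm.
    apply: crossing_turns; rewrite ?gne//; try exact: pth.
    have m0 : 0 < (2 ^+ m)^-1 :> R by rewrite invr_gt0 exprn_gt0.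
    apply: (angle_step ang) => //; first by rewrite dyadic_step; lra.
    move=> u; rewrite dyadic_step in_itv/= => /andP[ju uj].
    apply: lt_le_trans (rg _ j01); apply: near_s => //; last first.
      by rewrite ler_norml; lra.
    move: j01 j101; rewrite dyadic_step !in_itv/= => /andP[? ?] /andP[? ?]; lra.
  rewrite telescope_sumr// /th mul0r natrX divff ?expf_neq0// .
  have i0 : (0 : R) \in `[0, 1] by rewrite in_itv/= lexx ler01.
  have i1 : (1 : R) \in `[0, 1] by rewrite in_itv/= lexx ler01.
  have [c0 s0] := pth _ i0; have [c1 s1] := pth _ i1.
  have : cos (theta 1 - theta 0) = 1.
    by rewrite cosB c1 s1 -g01 -c0 -s0 -!expr2 cos2Dsin2.
  move=> /cos_eq1; set k := turns (theta 1 - theta 0) => kE.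
  have pi0 : 2 * pi != 0 :> R by rewrite mulf_neq0// gt_eqF// pi_gt0.
  have -> : theta 1 = theta 0 + 2 * pi * k%:~R by rewrite -kE; lra.
  have quot : 2 * pi * k%:~R / (2 * pi) = k%:~R :> R by rewrite mulrAC divff// mul1r.
  have -> : turns (theta 0 + 2 * pi * k%:~R) = turns (theta 0) + k.
    by rewrite /turns mulrDl quot floorDrz ?intr_int// intrKfloor.
  by rewrite addrAC subrr add0r quot rmorphD/= addrAC subrr add0r.
have [theta ctheta ptheta] : exists2 theta : R -> R, continuous theta &
    forall t, t \in `[0, 1] -> polar ((g \o clamp) t - z) (theta t).
  apply: (@angle_lift R _ z r (2 ^ m)) => //.
  - exact: continuous_clamp_fst hg.
  - exact: continuous_clamp_snd hg.
  - by rewrite expn_gt0.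
  - by move=> t; apply: rg; exact: clamp_itv.
  - move=> s t st; apply: near_s; [exact: clamp_itv|exact: clamp_itv|].
    by apply: le_trans (clamp_dist _ _) _; rewrite -natrX.
have ang : angle_function g z theta.
  split; first exact: continuous_subspaceT.
  by move=> t t01; have := ptheta t t01; rewrite /= clamp_id.
rewrite /wind; set P := (X in xget _ X).
have /(xgetPex 0)[_ [theta' ang' ->]] : exists w, P w.
  by exists ((theta 1 - theta 0) / (2 * pi)); split => //; exists theta.
exact: value.
Qed.

(** The condition of [wind_polygon_step] holds at every fine enough level. *)
Lemma wind_polygon (R : realType) (C : R) (g : R -> R * R) (z : R * R) :
  closed_curve g -> holder_sqr C g -> ~ curve_image g z ->
  \forall m \near \oo, wind g z = polygon_wind g m z.
Proof.
move=> g01 hg gz; have [r r0 rg] := distance_to_curve hg gz.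
have r2 : 0 < r ^+ 2 by rewrite exprn_gt0.
have : (fun m => C ^+ 2 / 2 ^+ m) @ \oo --> (0 : R).
  rewrite -[0](mulr0 (C ^+ 2)); apply: cvgM; first exact: cvg_cst.
  under eq_fun do rewrite -exprVn.
  by apply: cvg_expr; rewrite ger0_norm ?invr_ge0// invf_lt1 ?ltr1n.
move=> /cvgr_lt/(_ _ r2); apply: filterS => m rC.
exact: wind_polygon_step g01 hg gz r0 rg rC.
Qed.

Lemma wind_image (R : realType) (g : R -> R * R) (z : R * R) :
  curve_image g z -> wind g z = 0.
Proof. by move=> gz; apply: xgetPN => w []. Qed.

(** * The integral of the winding function of a polygon *)

Lemma integral_affine (R : realType) (p k c d : R) : c < d ->
  (\int[lebesgue_measure]_(y in `]c, d]) (p + k * (y - c))%:E =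
   (p * (d - c) + k / 2 * (d - c) ^+ 2)%:E)%E.
Proof.
move=> cd; pose F (y : R) := p * (y - c) + k / 2 * (y - c) ^+ 2.
have dF (y : R) : is_derive y 1 F (p + k * (y - c)).
  rewrite /F; apply: is_derive_eq.
  by rewrite !subr0 /GRing.scale/=; field.
have cf : continuous (fun y : R => p + k * (y - c)).
  move=> y; apply: cvgD; first exact: cvg_cst.
  by apply: cvgM; [exact: cvg_cst|apply: cvgB; [exact: cvg_id|exact: cvg_cst]].
have cF : continuous F.
  by move=> y; apply/differentiable_continuous/derivable1_diffP; exact: ex_derive.
rewrite integral_itv_obnd_cbnd; last first.
  apply/measurable_EFinP; apply: measurable_funTS.
  exact: continuous_measurable_fun.
rewrite (@continuous_FTC2 _ _ F)//.
- by rewrite /F -EFinB; congr EFin; rewrite subrr; ring.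
- exact: continuous_subspaceT.
- split; first by move=> y _; exact: ex_derive.
  + by apply: cvg_at_right_filter; exact: cF.
  + by apply: cvg_at_left_filter; exact: cF.
- by move=> y _; rewrite derive1E derive_val.
Qed.

Lemma measurable_cross (R : realType) (a b : R * R) :
  measurable_fun setT (fun z : plane R => cross (a - z) (b - z)).
Proof.
rewrite /cross/=.
by apply: measurable_funB; apply: measurable_funM; exact: measurable_funB.
Qed.

Lemma measurable_upcross (R : realType) (a b : R * R) :
  measurable [set z : plane R | upcross z a b].
Proof.
have : measurable_fun setT (fun z : plane R => upcross z a b).
  apply: measurable_and; last by apply: measurable_fun_ltr => //; exact: measurable_cross.
  by apply: measurable_and; [exact: measurable_fun_ltr|exact: measurable_fun_ler].
by move=> /(_ measurableT [set true]); rewrite setTI; exact.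
Qed.

(** The points to the left of an upward edge and at the height of one of its
points, cut at the abscissa [- B]. *)
Definition upregion {R : realType} (B : R) (a b : R * R) : set (plane R) :=
  [set z | - B <= z.1 /\ upcross z a b].

Lemma measurable_upregion (R : realType) (B : R) (a b : R * R) :
  measurable (upregion B a b).
Proof.
rewrite (_ : upregion B a b =
  fst @^-1` `[- B, +oo[%classic `&` [set z : plane R | upcross z a b]).
  apply: measurableI; last exact: measurable_upcross.
  by rewrite -[X in measurable X]setTI; exact: measurable_fst.
by apply/seteqP; split => z /=; rewrite in_itv/= andbT.
Qed.

Lemma lebesgue_planeE (R : realType) (A : set (plane R)) : measurable A ->
  lebesgue_plane A =
  (\int[lebesgue_measure]_y (lebesgue_measure (ysection A y)))%E.
Proof.
move=> mA; apply: (@product_measure_unique _ _ _ _ _ lebesgue_measure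
  lebesgue_measure (product_measure2 lebesgue_measure lebesgue_measure)) => //.
by move=> X Y mX mY; exact: product_measure2E.
Qed.

(** A horizontal section is an interval whose length is an affine function
of the height; the region is a trapezoid. *)
Lemma upregion_measure (R : realType) (B : R) (a b : R * R) :
  - B <= a.1 -> - B <= b.1 ->
  lebesgue_plane (upregion B a b) =
    (Num.max (b.2 - a.2) 0 * ((a.1 + b.1) / 2 + B))%:E.
Proof.
move=> Ba Bb; rewrite lebesgue_planeE; last exact: measurable_upregion.
have [ba|ab] := leP b.2 a.2.
  rewrite (max_idPr _) ?subr_le0// mul0r; apply: integral0_eq => y _.
  rewrite (_ : ysection _ y = set0) ?measure0// -subset0 => x.
  rewrite /ysection/= inE => -[_ /andP[/andP[/= ay yb] _]].
  by have := lt_le_trans ay (le_trans yb ba); rewrite ltxx.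
rewrite (max_idPl _) ?subr_ge0 1?ltW//.
pose k := (b.1 - a.1) / (b.2 - a.2); pose p := a.1 + B.
have ba0 : 0 < b.2 - a.2 by rewrite subr_gt0.
rewrite [LHS](_ : _ =
    \int[lebesgue_measure]_(y in `]a.2, b.2]) (p + k * (y - a.2))%:E)%E; last first.
  rewrite [RHS]integral_mkcond; apply: eq_integral => y _.
  rewrite patchE mem_setE in_itv/=; case: ifPn => [/andP[ay yb]|nab].
    have kb : k * (y - a.2) = (b.1 - a.1) * ((y - a.2) / (b.2 - a.2)).
      by rewrite /k mulrAC -mulrA.
    have t0 : 0 <= (y - a.2) / (b.2 - a.2) by rewrite divr_ge0// subr_ge0 ltW.
    have t1 : (y - a.2) / (b.2 - a.2) <= 1 by rewrite ler_pdivrMr// mul1r lerB.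
    have w0 : 0 <= p + k * (y - a.2).
      rewrite kb /p; set t := _ / _ in t0 t1 *; nra.
    rewrite (_ : ysection _ y = `[- B, a.1 + k * (y - a.2)[%classic); last first.
      have crE (x : R) : (0 < cross (a - (x, y)) (b - (x, y))) =
          (x < a.1 + k * (y - a.2)).
        rewrite -[RHS]subr_gt0 -[RHS](pmulr_lgt0 _ ba0) /cross/= /k.
        by congr (0 < _); field; rewrite gt_eqF.
      apply/seteqP; split => x; rewrite /ysection/= inE /upregion/upcross/= crE.
        by rewrite ay yb in_itv/= => -[-> ->].
      by rewrite ay yb in_itv/= => /andP[-> ->].
    rewrite lebesgue_measure_itv/= lte_fin; case: ltP => [_|le0].
      by rewrite -EFinB; congr EFin; rewrite /p; lra.
    by congr EFin; move: w0 le0; rewrite /p; lra.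
  rewrite (_ : ysection _ y = set0) ?measure0// -subset0 => x.
  rewrite /ysection/= inE => -[_ /andP[aby _]].
  by move: nab; rewrite aby.
rewrite integral_affine//; congr EFin; rewrite /p /k; field; rewrite gt_eqF//.
Qed.

(** The crossing number of a single edge is in general not integrable: it is
a nonzero constant on a region unbounded to the left.  Cutting at [- B] makes it
integrable. *)
Definition clipcross {R : realType} (B : R) (a b : R * R) (z : plane R) : R :=
  \1_(upregion B a b) z - \1_(upregion B b a) z.

Lemma clipcrossE (R : realType) (B : R) (a b : R * R) (z : plane R) :
  clipcross B a b z = if - B <= z.1 then crossing z a b else 0.
Proof.
rewrite /clipcross /crossing !indicE /upregion; case: ifPn => [Bz|Bz].
  have mem (c d : R * R) : (z \in [set z0 : plane R | - B <= z0.1 /\ upcross z0 c d])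
      = upcross z c d by apply/idP/idP; rewrite inE/=; [case|split].
  by rewrite !mem.
by rewrite !memNset ?subrr//= => -[Bz' _]; rewrite Bz' in Bz.
Qed.

Lemma integrable_upregion (R : realType) (B : R) (a b : R * R) :
  - B <= a.1 -> - B <= b.1 ->
  lebesgue_plane.-integrable setT (EFin \o (\1_(upregion B a b) : plane R -> R)).
Proof.
move=> Ba Bb; have mE := measurable_upregion B a b; apply/integrableP; split.
  by apply/measurable_EFinP; exact: measurable_indic.
under eq_integral do rewrite /= ger0_norm//.
by rewrite integral_indic// setIT upregion_measure// ltry.
Qed.

Lemma integrable_clipcross (R : realType) (B : R) (a b : R * R) :
  - B <= a.1 -> - B <= b.1 ->
  lebesgue_plane.-integrable setT (EFin \o clipcross B a b).
Proof.
move=> Ba Bb; rewrite (_ : EFin \o _ = (EFin \o (\1_(upregion B a b) : plane R -> R))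
  \- (EFin \o (\1_(upregion B b a) : plane R -> R)))%E; last exact/funext.
by apply: integrableB => //; exact: integrable_upregion.
Qed.

Lemma integral_clipcross (R : realType) (B : R) (a b : R * R) :
  - B <= a.1 -> - B <= b.1 ->
  (\int[lebesgue_plane]_z (clipcross B a b z)%:E =
    ((b.2 - a.2) * ((a.1 + b.1) / 2 + B))%:E)%E.
Proof.
move=> Ba Bb; under eq_integral do rewrite /clipcross EFinB.
rewrite integralB//; [|exact: integrable_upregion|exact: integrable_upregion].
rewrite !integral_indic//; [|exact: measurable_upregion|exact: measurable_upregion].
rewrite !setIT !upregion_measure// -EFinB; congr EFin.
have max_sub : Num.max (b.2 - a.2) 0 - Num.max (a.2 - b.2) 0 = b.2 - a.2.
  by case: (leP (b.2 - a.2) 0) => ?; case: (leP (a.2 - b.2) 0) => ?; lra.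
by rewrite (addrC b.1) -mulrBl max_sub.
Qed.

Definition shoelace {R : realType} (g : R -> R * R) (m : nat) : R :=
  2^-1 * \sum_(0 <= j < 2 ^ m) cross (node g m j) (node g m j.+1).

Lemma node0 (R : realType) (g : R -> R * R) (m : nat) : node g m 0 = g 0.
Proof. by rewrite /node mul0r. Qed.

Lemma node_last (R : realType) (g : R -> R * R) (m : nat) :
  node g m (2 ^ m) = g 1.
Proof. by rewrite /node natrX divff// expf_neq0. Qed.

Lemma crossing_left (R : realType) (z a b : R * R) :
  z.1 < a.1 -> z.1 < b.1 ->
  crossing z a b = (z.2 <= b.2)%R%:R - (z.2 <= a.2)%R%:R.
Proof.
move=> za zb; rewrite /crossing.
have up (c d : R * R) : z.1 < c.1 -> z.1 < d.1 ->
    upcross z c d = (c.2 < z.2) && (z.2 <= d.2).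
  move=> zc zd; rewrite /upcross; case: (ltP c.2 z.2) => //= cz.
  case: (leP z.2 d.2) => //= zd2; rewrite /cross/=.
  nra.
rewrite !up//; case: (ltP a.2 z.2) => az; case: (ltP b.2 z.2) => bz /=;
  by rewrite ?subrr ?subr0 ?sub0r.
Qed.

Lemma crossing_right (R : realType) (z a b : R * R) :
  a.1 < z.1 -> b.1 < z.1 -> crossing z a b = 0.
Proof.
move=> az bz; rewrite /crossing.
have up (c d : R * R) : c.1 < z.1 -> d.1 < z.1 -> upcross z c d = false.
  move=> cz dz; rewrite /upcross; case: (ltP c.2 z.2) => //= cz2.
  case: (leP z.2 d.2) => //= zd2; rewrite /cross/=; apply/negbTE; rewrite -leNgt.
  nra.
by rewrite !up// subrr.
Qed.

Lemma node_bound (R : realType) (C : R) (g : R -> R * R) : holder_sqr C g ->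
  exists B : R, forall m j, (j <= 2 ^ m)%N -> - B < (node g m j).1.
Proof.
move=> hg; exists (`|C| + `|(g 0).1| + 1) => m j jm.
have j01 := dyadic_itv R jm.
have i0 : (0 : R) \in `[0, 1] by rewrite in_itv/= lexx ler01.
have h : enorm (node g m j - g 0) <= `|C|.
  rewrite -ler_sqr ?nnegrE ?enorm_ge0// real_normK ?num_real//.
  apply: le_trans (hg _ _ j01 i0) _; rewrite ler_piMr ?sqr_ge0// subr0.
  by move: j01; rewrite in_itv/= => /andP[? ?]; rewrite ger0_norm.
have := le_trans (enorm_fst _) h; rewrite ler_norml/= => /andP[h1 _].
by have := ler_norm (- (g 0).1); rewrite normrN; lra.
Qed.

(** To the left of all the nodes the crossing numbers telescope to 0, so the
cut changes nothing for a closed polygon. *)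
Lemma polygon_wind_clip (R : realType) (B : R) (g : R -> R * R) (m : nat) :
  closed_curve g -> (forall j, (j <= 2 ^ m)%N -> - B < (node g m j).1) ->
  polygon_wind g m = fun z =>
    \sum_(0 <= j < 2 ^ m) clipcross B (node g m j) (node g m j.+1) z.
Proof.
move=> g01 hB; apply/funext => z.
under eq_bigr do rewrite clipcrossE.
case: (leP (- B) z.1) => // zB; rewrite [RHS]big1// /polygon_wind big_nat.
transitivity (\sum_(0 <= j < 2 ^ m | (0 <= j < 2 ^ m)%N)
    ((z.2 <= (node g m j.+1).2)%R%:R - (z.2 <= (node g m j).2)%R%:R : R)).
  apply: eq_bigr => j /andP[_ jm]; apply: crossing_left.
  - by apply: lt_trans (hB _ (ltnW jm)).
  - by apply: lt_trans (hB _ jm).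
by rewrite -big_nat telescope_sumr// node0 node_last g01 subrr.
Qed.

Lemma integrable_polygon_wind (R : realType) (C : R) (g : R -> R * R) (m : nat) :
  closed_curve g -> holder_sqr C g ->
  lebesgue_plane.-integrable setT (EFin \o polygon_wind g m).
Proof.
move=> g01 /node_bound[B hB]; rewrite (polygon_wind_clip g01 (hB m)).
rewrite (_ : EFin \o _ = fun z : plane R =>
    (\sum_(j < 2 ^ m) (clipcross B (node g m j) (node g m j.+1) z)%:E)%E).
  apply: integrable_sum => //= j _.
  by apply: integrable_clipcross; apply/ltW/hB; [exact: ltnW|].
by apply/funext => z /=; rewrite big_mkord sumEFin.
Qed.

(** The trapezoids of the edges add up to the shoelace formula; the terms
that involve [B] and the products of the coordinates of a single node
telescope. *)
Lemma integral_polygon_wind (R : realType) (C : R) (g : R -> R * R) (m : nat) :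
  closed_curve g -> holder_sqr C g ->
  (\int[lebesgue_plane]_z (polygon_wind g m z)%:E = (shoelace g m)%:E)%E.
Proof.
move=> g01 /node_bound[B hB]; rewrite (polygon_wind_clip g01 (hB m)).
under eq_integral do rewrite -sumEFin big_mkord.
have node_ge (j : 'I_(2 ^ m)) : - B <= (node g m j).1 /\ - B <= (node g m j.+1).1.
  by split; apply/ltW/hB => //; exact: ltnW.
rewrite integral_sum//=; last first.
  by move=> j; have [? ?] := node_ge j; exact: integrable_clipcross.
under eq_bigr => j _.
  rewrite integral_clipcross; [|exact: (node_ge j).1|exact: (node_ge j).2].
over.
rewrite sumEFin -(big_mkord xpredT (fun j => ((node g m j.+1).2 - (node g m j).2) *
  (((node g m j).1 + (node g m j.+1).1) / 2 + B))); congr EFin.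
(* The difference between a trapezoid and half a cross product is an increment
   of [T]. *)
pose T j := 2^-1 * (node g m j).1 * (node g m j).2 + B * (node g m j).2.
transitivity (shoelace g m + \sum_(0 <= j < 2 ^ m) (T j.+1 - T j)).
  rewrite /shoelace mulr_sumr -big_split/=; apply: eq_bigr => j _.
  by rewrite /T /cross; field.
by rewrite telescope_sumr// /T node0 node_last g01 subrr addr0.
Qed.

(** * Domination of the winding functions of the dyadic polygons *)

Definition square {R : realType} (c : R * R) (s : R) : set (plane R) :=
  `[c.1 - s, c.1 + s]%classic `*` `[c.2 - s, c.2 + s]%classic.

Lemma in_square (R : realType) (c : R * R) (s : R) (z : plane R) :
  square c s z <-> `|z.1 - c.1| <= s /\ `|z.2 - c.2| <= s.
Proof. by rewrite /square/= !in_itv/= !ler_distl. Qed.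

Lemma measurable_square (R : realType) (c : R * R) (s : R) :
  measurable (square c s).
Proof. by apply: measurableX; exact: measurable_itv. Qed.

Lemma square_measure (R : realType) (c : R * R) (s : R) : 0 <= s ->
  lebesgue_plane (square c s) = (4 * s ^+ 2)%:E.
Proof.
move=> s0; have side (x : R) :
    lebesgue_measure (`[x - s, x + s]%classic : set R) = (2 * s)%:E.
  rewrite lebesgue_measure_itv/= lte_fin; case: ltP => [_|h].
    by rewrite -EFinB; congr EFin; lra.
  by congr EFin; lra.
rewrite /lebesgue_plane/= /square product_measure1E;
  [|exact: measurable_itv|exact: measurable_itv].
transitivity ((2 * s)%:E * (2 * s)%:E)%E; first by congr (_ * _)%E; exact: side.
by rewrite -EFinM; congr EFin; lra.
Qed.

Lemma crossing_diag (R : realType) (z a : R * R) : crossing z a a = 0.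
Proof. by rewrite /crossing subrr. Qed.

Lemma crossing_above (R : realType) (z a b : R * R) :
  a.2 < z.2 -> b.2 < z.2 -> crossing z a b = 0.
Proof.
by move=> az bz; rewrite /crossing /upcross (leNgt z.2 b.2) (leNgt z.2 a.2)
  az bz subrr.
Qed.

Lemma crossing_below (R : realType) (z a b : R * R) :
  z.2 < a.2 -> z.2 < b.2 -> crossing z a b = 0.
Proof.
by move=> az bz; rewrite /crossing /upcross !ltNge (ltW az) (ltW bz) subrr.
Qed.

Lemma crossing_le1 (R : realType) (z a b : R * R) : `|crossing z a b| <= 1.
Proof.
by rewrite /crossing; case: upcross; case: upcross;
  rewrite ?subrr ?subr0 ?sub0r ?normrN ?normr0 ?normr1.
Qed.

(** The left side is the winding function of a closed triangle: it vanishes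
at a point to the left, to the right, above or below all three vertices.  Each crossing number is
at most 1 in absolute value, whence the factor 3. *)
Lemma triangle_support (R : realType) (z a p b : R * R) (s : R) :
  enorm (p - a) <= s -> enorm (b - a) <= s ->
  `|crossing z a p + crossing z p b - crossing z a b|
    <= 3 * \1_(square a s) z.
Proof.
move=> pa ba; rewrite indicE; case: (boolP (z \in square a s)) => [_|].
  rewrite mulr1; apply: le_trans (ler_normB _ _) _.
  have := ler_normD (crossing z a p) (crossing z p b).
  have := crossing_le1 z a p; have := crossing_le1 z p b.
  have := crossing_le1 z a b; lra.
rewrite notin_setE in_square => nsq; rewrite mulr0.
suff -> : crossing z a p + crossing z p b - crossing z a b = 0 by rewrite normr0.
have p1 := le_trans (enorm_fst _) pa; have p2 := le_trans (enorm_snd _) pa.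
have b1 := le_trans (enorm_fst _) ba; have b2 := le_trans (enorm_snd _) ba.
move: p1 p2 b1 b2; rewrite /= !ler_norml.
move=> /andP[p1 p1'] /andP[p2 p2'] /andP[b1 b1'] /andP[b2 b2'].
have s0 : 0 <= s by apply: le_trans ba; exact: enorm_ge0.
have [z1|z1] := ltP (a.1 + s) z.1.
  have [? ? ?] : [/\ a.1 < z.1, p.1 < z.1 & b.1 < z.1] by split; lra.
  by rewrite !crossing_right// addr0 subrr.
have [z1'|z1'] := ltP z.1 (a.1 - s).
  have [? ? ?] : [/\ z.1 < a.1, z.1 < p.1 & z.1 < b.1] by split; lra.
  by rewrite !crossing_left//; ring.
have [z2|z2] := ltP (a.2 + s) z.2.
  have [? ? ?] : [/\ a.2 < z.2, p.2 < z.2 & b.2 < z.2] by split; lra.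
  by rewrite !crossing_above// addr0 subrr.
have [z2'|z2'] := ltP z.2 (a.2 - s).
  have [? ? ?] : [/\ z.2 < a.2, z.2 < p.2 & z.2 < b.2] by split; lra.
  by rewrite !crossing_below// addr0 subrr.
by exfalso; apply: nsq; rewrite !ler_norml; split; apply/andP; split; lra.
Qed.

Lemma node_double (R : realType) (g : R -> R * R) (m j : nat) :
  node g m.+1 (2 * j) = node g m j.
Proof.
by rewrite /node natrM exprS invfM mulrACA divff// mul1r.
Qed.

Definition triangle_bound {R : realType} (g : R -> R * R)
    (E : nat -> nat -> R) (m : nat) (z : plane R) : R :=
  \sum_(0 <= j < 2 ^ m) 3 * \1_(square (node g m j) (Num.sqrt (E m j))) z.

(** The crossings of the two halves minus those of the edge they replace are
those of a triangle. *)
Lemma polygon_wind_step (R : realType) (C : R) (g : R -> R * R)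
    (E : nat -> nat -> R) (m : nat) (z : plane R) :
  dyadic_system C (node g) E ->
  `|polygon_wind g m.+1 z - polygon_wind g m z| <= triangle_bound g E m z.
Proof.
move=> sys; have E0 := dyadic_E_ge0 sys.
rewrite /polygon_wind expnS -[in X in X - _](muln0 2) big_nat_double -sumrB.
apply: le_trans (ler_norm_sum _ _ _) _.
rewrite big_nat [leRHS]big_nat; apply: ler_sum => j /andP[_ jm].
rewrite (_ : (2 * j).+2 = (2 * j.+1)%N); last by lia.
rewrite !node_double; apply: triangle_support.
- rewrite -[leLHS]ger0_norm ?enorm_ge0// -sqrtr_sqr ler_wsqrtr//.
  exact: dyadic_mid sys _ _ jm.
- rewrite -[leLHS]ger0_norm ?enorm_ge0// -sqrtr_sqr ler_wsqrtr//.
  exact: dyadic_chord sys _ _ jm.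
Qed.

(** The polygon of level 0 is a single degenerate edge, since the curve is
closed. *)
Lemma polygon_wind_bound (R : realType) (C : R) (g : R -> R * R)
    (E : nat -> nat -> R) (m : nat) (z : plane R) :
  closed_curve g -> dyadic_system C (node g) E ->
  `|polygon_wind g m z| <= \sum_(0 <= i < m) triangle_bound g E i z.
Proof.
move=> g01 sys; elim: m => [|m IH].
  rewrite big_geq// /polygon_wind expn0 big_nat1.
  by rewrite node0 (node_last g 0) g01 crossing_diag normr0.
rewrite big_nat_recr//=; have := polygon_wind_step m z sys.
have := ler_normD (polygon_wind g m.+1 z - polygon_wind g m z) (polygon_wind g m z).
rewrite subrK; lra.
Qed.

Lemma triangle_bound_ge0 (R : realType) (g : R -> R * R)
    (E : nat -> nat -> R) (m : nat) (z : plane R) : 0 <= triangle_bound g E m z.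
Proof. by apply: sumr_ge0 => j _; rewrite mulr_ge0. Qed.

Lemma measurable_triangle_bound (R : realType) (g : R -> R * R)
    (E : nat -> nat -> R) (m : nat) :
  measurable_fun setT (triangle_bound g E m).
Proof.
apply: measurable_sum => j; apply: measurable_funM => //.
by apply: measurable_indic; exact: measurable_square.
Qed.

Lemma integral_triangle_bound (R : realType) (g : R -> R * R)
    (E : nat -> nat -> R) (m : nat) : (forall i j, 0 <= E i j) ->
  (\int[lebesgue_plane]_z (triangle_bound g E m z)%:E =
    (12 * \sum_(0 <= j < 2 ^ m) E m j)%:E)%E.
Proof.
move=> E0; under eq_integral do rewrite -sumEFin.
have msq j : measurable (square (node g m j) (Num.sqrt (E m j))).
  exact: measurable_square.
rewrite ge0_integral_sum//=.
- rewrite mulr_sumr -sumEFin; apply: eq_bigr => j _.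
  under eq_integral do rewrite EFinM.
  rewrite ge0_integralZl//; last exact/measurable_EFinP/measurable_indic.
  rewrite integral_indic// setIT square_measure ?sqrtr_ge0// sqr_sqrtr//.
  by rewrite -EFinM; congr EFin; lra.
- by move=> j; apply/measurable_EFinP; apply: measurable_funM.
Qed.

(** The integrable function that dominates the winding functions of all the
dyadic polygons. *)
Definition wind_bound {R : realType} (g : R -> R * R) (E : nat -> nat -> R)
    (z : plane R) : \bar R :=
  (\sum_(0 <= m <oo) (triangle_bound g E m z)%:E)%E.

(** The square attached to a triple has side twice the square root of its
energy, so the integral is 12 times the given series. *)
Lemma integrable_wind_bound (R : realType) (g : R -> R * R)
    (E : nat -> nat -> R) : (forall i j, 0 <= E i j) ->
  (\sum_(0 <= m <oo) (\sum_(0 <= j < 2 ^ m) E m j)%:E < +oo)%E ->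
  lebesgue_plane.-integrable setT (wind_bound g E).
Proof.
move=> E0 Esum; have mb m : measurable_fun setT (EFin \o triangle_bound g E m).
  by apply/measurable_EFinP; exact: measurable_triangle_bound.
have b0 m z : (0 <= (triangle_bound g E m z)%:E)%E.
  by rewrite lee_fin triangle_bound_ge0.
apply/integrableP; split; first exact: (@ge0_emeasurable_sum
  _ _ R setT (fun m z => (triangle_bound g E m z)%:E) xpredT
  (fun m z _ _ => b0 m z) (fun m _ => mb m)).
under eq_integral do rewrite gee0_abs ?nneseries_ge0//.
rewrite integral_nneseries//.
under eq_eseriesr do rewrite integral_triangle_bound// EFinM.
rewrite nneseriesZl//; first by rewrite lte_mul_pinfty// ?lee_fin.
by move=> m _; rewrite lee_fin sumr_ge0.
Qed.

Lemma polygon_wind_dominated (R : realType) (C : R) (g : R -> R * R)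
    (E : nat -> nat -> R) (m : nat) (z : plane R) :
  closed_curve g -> dyadic_system C (node g) E ->
  (`|(polygon_wind g m z)%:E| <= wind_bound g E z)%E.
Proof.
move=> g01 sys.
apply: (@le_trans _ _ (\sum_(0 <= i < m) triangle_bound g E i z)%:E).
  by rewrite lee_fin; exact: polygon_wind_bound g01 sys.
rewrite -sumEFin; apply: nneseries_lim_ge => i _ _.
by rewrite lee_fin triangle_bound_ge0.
Qed.

(** * Covering the curve by squares of small total area *)

Lemma dyadic_tail (R : realType) (S : nat -> R) (eps : R) :
  (forall m, 0 <= S m) -> (\sum_(0 <= m <oo) (S m)%:E < +oo)%E -> 0 < eps ->
  exists n, forall r, \sum_(n <= m < n + r) S m < eps.
Proof.
move=> S0 Ssum eps0; pose A := [set \sum_(0 <= m < n) S m | n in [set: nat]].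
have A0 : A !=set0 by exists (\sum_(0 <= m < 0) S m), 0%N.
have ubA : ubound A (fine (\sum_(0 <= m <oo) (S m)%:E)%E).
  move=> _ [n _ <-]; rewrite -lee_fin fineK; last first.
    by rewrite ge0_fin_numE// nneseries_ge0// => m _ _; rewrite lee_fin.
  by rewrite -sumEFin; apply: nneseries_lim_ge => m _ _; rewrite lee_fin.
have supA : has_sup A by split => //; exists (fine (\sum_(0 <= m <oo) (S m)%:E)%E).
have [_ [n _ <-] nsup] := sup_adherent eps0 supA.
exists n => r.
have : \sum_(0 <= m < n + r) S m <= sup A.
  by apply: sup_upper_bound => //; exists (n + r)%N.
rewrite (big_cat_nat (n := n))//= ?leq_addr//; lra.
Qed.

Lemma sum_blocks (R : realType) (F : nat -> R) (k q : nat) :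
  \sum_(0 <= j < k) \sum_((j * q)%N <= i < (j.+1 * q)%N) F i =
  \sum_(0 <= i < (k * q)%N) F i.
Proof.
elim: k => [|k IH]; first by rewrite !big_geq.
rewrite big_nat_recr//= IH -big_cat_nat//= leq_mul2r leqnSn orbT//.
Qed.

Lemma sqr_sum_le (R : realType) (y : nat -> R) (k : nat) :
  (\sum_(0 <= i < k) y i) ^+ 2 <= 2 ^+ k * \sum_(0 <= i < k) y i ^+ 2.
Proof.
elim: k => [|k IH]; first by rewrite !big_geq// expr0n mulr0.
rewrite !big_nat_recr//= [2 ^+ k.+1]exprS.
set s := \sum_(0 <= i < k) y i in IH *; set s2 := \sum_(0 <= i < k) _ in IH *.
have := sqr_ge0 (s - y k).
have : y k ^+ 2 <= 2 ^+ k * y k ^+ 2.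
  by rewrite ler_peMl ?sqr_ge0// -natrX ler1n expn_gt0.
lra.
Qed.

(** A bound for every edge of level [n + i] over the [j]-th dyadic interval of
level [n]. *)
Definition block_norm {R : realType} (E : nat -> nat -> R) (n j i : nat) : R :=
  Num.sqrt (\sum_((j * 2 ^ i)%N <= l < (j.+1 * 2 ^ i)%N) E (n + i)%N l).

(** The node [k] of level [n + r] is joined to the node of level [n] at the
left of it through the nodes obtained by dropping the binary digits of [k] one
by one.  The map [pr] is one of the two coordinates. *)
Lemma node_descent (R : realType) (C : R) (g : R -> R * R)
    (E : nat -> nat -> R) (n r k : nat) (pr : R * R -> R) :
  (forall u, `|pr u| <= enorm u) -> (forall u v, pr (u - v) = pr u - pr v) ->
  dyadic_system C (node g) E -> (k < 2 ^ (n + r))%N ->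
  `|pr (node g (n + r)%N k) - pr (node g n (k %/ 2 ^ r)%N)|
    <= \sum_(0 <= i < r) block_norm E n (k %/ 2 ^ r)%N i.
Proof.
move=> pr_norm prB sys; have E0 := dyadic_E_ge0 sys.
elim: r k => [|r IH] k kr.
  by rewrite addn0 expn0 divn1 subrr normr0 big_geq.
have kE : (k %/ 2 ^ r.+1 = k./2 %/ 2 ^ r)%N by rewrite expnS divnMA divn2.
have k2 : (k./2 < 2 ^ (n + r))%N by move: kr; rewrite addnS expnS; lia.
rewrite kE big_nat_recr//= addrC.
rewrite -(subrK (pr (node g (n + r)%N k./2)) (pr (node g _ k))) -addrA.
apply: le_trans (ler_normD _ _) _; apply: lerD (IH _ k2).
rewrite -prB addnS; apply: le_trans (pr_norm _) _.
have half : enorm (node g (n + r).+1 k - node g (n + r)%N k./2)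
    <= Num.sqrt (E (n + r)%N k./2).
  have [kodd|keven] := boolP (odd k).
    have -> : k = (2 * k./2).+1 by lia.
    rewrite (_ : (2 * k./2).+1./2 = k./2); last by lia.
    rewrite -[leLHS]ger0_norm ?enorm_ge0// -sqrtr_sqr ler_wsqrtr//.
    exact: dyadic_mid sys _ _ k2.
  rewrite (_ : node g (n + r).+1 k = node g (n + r)%N k./2).
    by rewrite subrr /enorm/= expr0n/= addr0 sqrtr0 sqrtr_ge0.
  by rewrite -(node_double g (n + r)); congr (node g _ _); lia.
apply: le_trans half _; rewrite /block_norm ler_wsqrtr//.
have q0 : (0 < 2 ^ r)%N by rewrite expn_gt0.
have lo := leq_trunc_div k./2 (2 ^ r).
have hi := ltn_ceil k./2 q0.
rewrite (big_cat_nat (n := k./2))//=; last exact: ltnW.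
rewrite [X in _ + X](big_cat_nat (n := k./2.+1))//=.
by rewrite big_nat1 addrCA lerDl addr_ge0// sumr_ge0.
Qed.

Lemma dyadic_trunc (R : realType) (m : nat) (t : R) : 0 <= t ->
  `|t - (Num.truncn (t * 2 ^+ m))%:R / 2 ^+ m| <= (2 ^+ m)^-1.
Proof.
move=> t0; have m0 : 0 < 2 ^+ m :> R by rewrite exprn_gt0.
have /truncn_itv/andP[lo hi] : 0 <= t * 2 ^+ m by rewrite mulr_ge0// ltW.
rewrite ler_norml; apply/andP; split.
  rewrite -(ler_pM2r m0) mulrBl divfK ?gt_eqF// mulNr mulVf ?gt_eqF//.
  lra.
rewrite -(ler_pM2r m0) mulrBl divfK ?gt_eqF// mulVf ?gt_eqF//.
by rewrite lerBlDl natr1 ltW.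
Qed.

Lemma trunc_node (R : realType) (C : R) (g : R -> R * R) (m : nat) (t : R) :
  holder_sqr C g -> t \in `[0, 1] ->
  let k := Num.truncn (t * 2 ^+ m) in
  [/\ (k <= 2 ^ m)%N, t < 1 -> (k < 2 ^ m)%N &
      enorm (g t - node g m k) ^+ 2 <= C ^+ 2 / 2 ^+ m].
Proof.
move=> hg t01 k; move: (t01); rewrite in_itv/= => /andP[t0 t1].
have m0 : 0 < 2 ^+ m :> R by rewrite exprn_gt0.
have kt : k%:R <= t * 2 ^+ m by rewrite truncn_le mulr_ge0// ltW.
have km : (k <= 2 ^ m)%N.
  by rewrite -(ler_nat R) natrX; apply: le_trans kt _; rewrite ger_pMl.
split=> // [t1'|].
  by rewrite -(ltr_nat R) natrX; apply: le_lt_trans kt _; rewrite gtr_pMl.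
apply: le_trans (hg _ _ t01 (dyadic_itv R km)) _.
by rewrite ler_wpM2l ?sqr_ge0//; exact: dyadic_trunc.
Qed.

(** Parameter 1 falls back on node 0, as the curve is closed. *)
Lemma curve_node (R : realType) (C : R) (g : R -> R * R) (m : nat) (t : R) :
  closed_curve g -> holder_sqr C g -> t \in `[0, 1] ->
  exists2 k, (k < 2 ^ m)%N & enorm (g t - node g m k) ^+ 2 <= C ^+ 2 / 2 ^+ m.
Proof.
move=> g01 hg t01; have [t1|t1] := ltP t 1.
  by have [_ km near_k] := trunc_node m hg t01; exists (Num.truncn (t * 2 ^+ m));
    first exact: km.
have i0 : (0 : R) \in `[0, 1] by rewrite in_itv/= lexx ler01.
have -> : t = 1.
  by move: t01; rewrite in_itv/= => /andP[_ ?]; apply/eqP; rewrite eq_le t1 andbT.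
have [_ km near_k] := trunc_node m hg i0; rewrite -g01.
by exists (Num.truncn (0 * 2 ^+ m : R)); first exact: km.
Qed.

(** The half-side of the [j]-th square is the length of a descent over [M]
levels plus the Hölder distance from the last node to the curve.  Here [M] is
chosen first, to make small the sum of the squared Hölder distances, and [n]
afterwards, to make the tail of the series small compared with [2 ^- M.+1]. *)
Lemma squares_cover (R : realType) (C : R) (g : R -> R * R)
    (E : nat -> nat -> R) (eps : R) :
  closed_curve g -> holder_sqr C g -> dyadic_system C (node g) E ->
  (\sum_(0 <= m <oo) (\sum_(0 <= j < 2 ^ m) E m j)%:E < +oo)%E -> 0 < eps ->
  exists n (X : nat -> R), [/\ forall j, 0 <= X j,
    \sum_(0 <= j < 2 ^ n) X j ^+ 2 <= eps &
    forall t, t \in `[0, 1] -> exists2 j, (j < 2 ^ n)%N &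
      square (node g n j) (X j) (g t)].
Proof.
move=> g01 hg sys Esum eps0; have E0 := dyadic_E_ge0 sys.
have [M hM] : exists M, 2 * C ^+ 2 / 2 ^+ M < eps / 2.
  have : (fun m => 2 * C ^+ 2 / 2 ^+ m) @ \oo --> (0 : R).
    rewrite -[0](mulr0 (2 * C ^+ 2)); apply: cvgM; first exact: cvg_cst.
    under eq_fun do rewrite -exprVn.
    by apply: cvg_expr; rewrite ger0_norm ?invr_ge0// invf_lt1 ?ltr1n.
  have e2 : 0 < eps / 2 by rewrite divr_gt0.
  by move=> /cvgr_lt/(_ _ e2)[M _ hM]; exists M; apply: hM => /=.
pose S m := \sum_(0 <= j < 2 ^ m) E m j.
have S0 m : 0 <= S m by rewrite sumr_ge0.
have e0 : 0 < eps / 2 / 2 ^+ M.+1 by rewrite !divr_gt0// exprn_gt0.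
have [n /(_ M) tail] := dyadic_tail S0 Esum e0.
pose h := Num.sqrt (C ^+ 2 / 2 ^+ (n + M)).
pose Y j := \sum_(0 <= i < M) block_norm E n j i.
have h0 : 0 <= h by exact: sqrtr_ge0.
have h2 : h ^+ 2 = C ^+ 2 / 2 ^+ (n + M).
  by rewrite sqr_sqrtr// divr_ge0 ?sqr_ge0// exprn_ge0.
have Y0 j : 0 <= Y j by rewrite sumr_ge0// => i _; exact: sqrtr_ge0.
exists n, (fun j => Y j + h); split.
- by move=> j; rewrite addr_ge0.
- have Xsq j : (Y j + h) ^+ 2 <= 2 ^+ M.+1 *
      (\sum_(0 <= i < M) \sum_((j * 2 ^ i)%N <= l < (j.+1 * 2 ^ i)%N) E (n + i)%N l)
      + 2 * C ^+ 2 / 2 ^+ (n + M).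
    have := sqr_sum_le (block_norm E n j) M; rewrite -/(Y j).
    under eq_bigr do rewrite sqr_sqrtr ?sumr_ge0//.
    rewrite -[2 * C ^+ 2 / _]mulrA -h2 [2 ^+ M.+1]exprS.
    have := sqr_ge0 (Y j - h); lra.
  apply: (le_trans (ler_sum _ (fun j _ => Xsq j))).
  rewrite big_split/= -mulr_sumr exchange_big/=.
  have -> : \sum_(0 <= i < M) \sum_(0 <= j < 2 ^ n)
      \sum_((j * 2 ^ i)%N <= l < (j.+1 * 2 ^ i)%N) E (n + i)%N l =
      \sum_(n <= m < n + M) S m.
    rewrite -[n in RHS]add0n (addnC n M) big_addn addnK.
    by apply: eq_bigr => i _; rewrite sum_blocks -expnD addnC.
  rewrite sumr_const_nat subn0 -[_ *+ (2 ^ n)]mulr_natl natrX.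
  have -> : 2 ^+ n * (2 * C ^+ 2 / 2 ^+ (n + M)) = 2 * C ^+ 2 / 2 ^+ M.
    by rewrite exprD; field; rewrite !expf_neq0.
  move: tail; rewrite ltr_pdivlMr ?exprn_gt0// mulrC; lra.
- move=> t t01; have [k kn near_k] := curve_node (n + M) g01 hg t01.
  exists (k %/ 2 ^ M)%N; first by rewrite ltn_divLR ?expn_gt0// -expnD.
  have near_k' : enorm (g t - node g (n + M) k) <= h.
    by rewrite -[leLHS]ger0_norm ?enorm_ge0// -sqrtr_sqr ler_wsqrtr.
  have side (pr : R * R -> R) : (forall u, `|pr u| <= enorm u) ->
      (forall u v, pr (u - v) = pr u - pr v) ->
      `|pr (g t) - pr (node g n (k %/ 2 ^ M)%N)| <= Y (k %/ 2 ^ M)%N + h.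
    move=> pr_norm prB.
    rewrite -(subrK (pr (node g (n + M)%N k)) (pr (g t))) -addrA addrC.
    apply: le_trans (ler_normD _ _) _; apply: lerD.
      exact: node_descent pr_norm prB sys kn.
    by rewrite -prB; apply: le_trans (pr_norm _) near_k'.
  by apply/in_square; split; [apply: (side fst) => //|apply: (side snd) => //];
    [exact: enorm_fst|exact: enorm_snd].
Qed.

(** * The dyadic triples, and the nullity of the curve *)

Lemma ediam_ge0 (R : realType) (A : set (R * R)) : (0 <= ediam A)%E.
Proof. by rewrite /ediam le_max lexx. Qed.

Lemma enorm_le_ediam (R : realType) (A : set (R * R)) (x y : R * R) :
  A x -> A y -> ((enorm (x - y))%:E <= ediam A)%E.
Proof.
move=> Ax Ay; rewrite /ediam le_max; apply/orP; right.
by apply: ereal_sup_ubound; exists x => //; exists y.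
Qed.

Lemma ediam_le (R : realType) (A : set (R * R)) (s : R) : 0 <= s ->
  (forall x y, A x -> A y -> enorm (x - y) <= s) -> (ediam A <= s%:E)%E.
Proof.
move=> s0 As; rewrite /ediam ge_max lee_fin s0/=.
by apply: ge_ereal_sup => _ [x Ax [y Ay <-]]; rewrite lee_fin As.
Qed.

Lemma ediam_triple_fin (R : realType) (p q r : R * R) :
  ediam [set p; q; r] \is a fin_num.
Proof.
pose s := enorm (p - q) + enorm (p - r) + enorm (q - r).
rewrite ge0_fin_numE ?ediam_ge0//; apply: le_lt_trans (ltry s).
have e1 := enorm_ge0 (p - q); have e2 := enorm_ge0 (p - r).
have e3 := enorm_ge0 (q - r).
have e0 (x : R * R) : enorm (x - x) = 0.
  by rewrite subrr /enorm/= expr0n/= addr0 sqrtr0.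
apply: ediam_le => [|x y]; first by rewrite /s !addr_ge0.
by move=> [[->|->]|->] [[->|->]|->]; rewrite ?e0 ?(enorm_distC q p)
  ?(enorm_distC r p) ?(enorm_distC r q) /s; lra.
Qed.

(** The exact diameter is [2 * sqrt 2 * s]. *)
Lemma ediam_square (R : realType) (c : R * R) (s : R) : 0 <= s ->
  (ediam (square c s : set (R * R)) <= (3 * s)%:E)%E.
Proof.
move=> s0; apply: ediam_le => [|x y]; first by rewrite mulr_ge0.
move=> /in_square[]; rewrite !ler_norml => /andP[? ?] /andP[? ?].
move=> /in_square[]; rewrite !ler_norml => /andP[? ?] /andP[? ?].
rewrite -ler_sqr ?nnegrE ?enorm_ge0 ?mulr_ge0// enorm_sqr/=.
have side u v : - s <= u -> u <= s -> - s <= v -> v <= s ->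
    (u - v) ^+ 2 <= 4 * s ^+ 2 by move=> *; nra.
have := side (x.1 - c.1) (y.1 - c.1) ltac:(lra) ltac:(lra) ltac:(lra) ltac:(lra).
have := side (x.2 - c.2) (y.2 - c.2) ltac:(lra) ltac:(lra) ltac:(lra) ltac:(lra).
have := sqr_ge0 s.
rewrite (_ : x.1 - c.1 - (y.1 - c.1) = x.1 - y.1); last by lra.
rewrite (_ : x.2 - c.2 - (y.2 - c.2) = x.2 - y.2); last by lra.
lra.
Qed.

Definition triple_energy {R : realType} (g : R -> R * R) (m j : nat) : R :=
  fine (ediam (dyadic_triple g m j)) ^+ 2.

Lemma triple_energyE (R : realType) (g : R -> R * R) (m j : nat) :
  (ediam (dyadic_triple g m j) ^+ 2)%E = (triple_energy g m j)%:E.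
Proof. by rewrite /triple_energy EFin_expe fineK//; exact: ediam_triple_fin. Qed.

Lemma triple_system (R : realType) (C : R) (g : R -> R * R) :
  0 <= C -> holder_sqr C g -> dyadic_system C (node g) (triple_energy g).
Proof.
move=> C0 hg.
have energy m j x y : dyadic_triple g m j x -> dyadic_triple g m j y ->
    enorm (x - y) ^+ 2 <= triple_energy g m j.
  move=> xm ym; rewrite /triple_energy ler_sqr ?nnegrE ?enorm_ge0 ?fine_ge0 ?ediam_ge0//.
  rewrite -lee_fin fineK; last exact: ediam_triple_fin.
  exact: enorm_le_ediam.
split=> //.
- by move=> m j; rewrite sqr_ge0.
- by move=> m j; exact: node_double.
- move=> m a b /andP[ab bm].
  apply: le_trans (hg _ _ (dyadic_itv R bm) (dyadic_itv R (leq_trans ab bm))) _.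
  rewrite -mulrBl -natrB// normrM normfV !ger0_norm ?exprn_ge0//.
- move=> m j _; apply: energy; first by right; rewrite /node addn1.
  by left; left.
- move=> m j _; apply: energy; first by left; right; rewrite /node addn1.
  by left; left.
Qed.

(** In the covers of [squares_cover] the total of the squared sides bounds
each of them, so the restriction on the diameters comes for free. *)
Lemma hausdorff2_image (R : realType) (C : R) (g : R -> R * R)
    (E : nat -> nat -> R) :
  closed_curve g -> holder_sqr C g -> dyadic_system C (node g) E ->
  (\sum_(0 <= m <oo) (\sum_(0 <= j < 2 ^ m) E m j)%:E < +oo)%E ->
  hausdorff2 (curve_image g) = 0%E.
Proof.
move=> g01 hg sys Esum.
have pi40 : 0 <= pi / 4 :> R by rewrite divr_ge0// pi_ge0.
have sum0 (U : nat -> set (R * R)) : (0 <= \sum_(0 <= k <oo) ediam (U k) ^+ 2)%E.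
  by apply: nneseries_ge0 => k _ _; rewrite expe_ge0// ediam_ge0.
have pre0 delta : 0 < delta -> hausdorff2_pre delta (curve_image g) = 0%E.
  move=> delta0; apply/eqP; rewrite eq_le; apply/andP; split; last first.
    by apply: le_ereal_inf_tmp => _ [U _ <-]; rewrite mule_ge0 ?lee_fin.
  apply/lee_addgt0Pr => e e0; rewrite add0e.
  (* A square of half-side [s] has diameter at most [3 * s]: the first bound
     controls the total, the second one keeps each diameter below [delta]. *)
  pose eps := Num.min (e / (9 * pi)) ((delta / 3) ^+ 2).
  have eps0 : 0 < eps.
    by rewrite lt_min !divr_gt0 ?mulr_gt0 ?pi_gt0.
  have [n [X [X0 Xsum Xcov]]] := squares_cover g01 hg sys Esum eps0.
  pose U k : set (R * R) := if (k < 2 ^ n)%N then square (node g n k) (X k) else set0.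
  have ediamU0 k : (2 ^ n <= k)%N -> ediam (U k) = 0%E.
    move=> nk; apply/eqP; rewrite eq_le ediam_ge0 andbT /U ltnNge nk/=.
    by apply: ediam_le.
  have Xle k : (k < 2 ^ n)%N -> X k ^+ 2 <= eps.
    move=> kn; apply: le_trans Xsum.
    rewrite (big_cat_nat (n := k))//=; last exact: ltnW.
    rewrite [X in _ + X](big_cat_nat (n := k.+1))//=.
    by rewrite big_nat1 addrCA lerDl addr_ge0// sumr_ge0// => i _; exact: sqr_ge0.
  apply: (@le_trans _ _ ((pi / 4)%:E * \sum_(0 <= k <oo) ediam (U k) ^+ 2)%E).
    apply: ereal_inf_lbound; exists U => //; split.
      move=> _ [t t01 <-]; have [k kn gt] := Xcov t t01.
      by exists k => //; rewrite /U kn.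
    move=> k; have [nk|kn] := leqP (2 ^ n) k.
      by rewrite ediamU0// lee_fin ltW.
    rewrite /U kn; apply: le_trans (ediam_square _ (X0 k)) _; rewrite lee_fin.
    rewrite mulrC -ler_pdivlMr// -ler_sqr ?nnegrE ?divr_ge0//; last exact: ltW.
    by apply: le_trans (Xle k kn) _; rewrite ge_min lexx orbT.
  rewrite (nneseries_split 0 (2 ^ n)); last first.
    by move=> k _; rewrite expe_ge0// ediam_ge0.
  rewrite add0n eseries0 ?adde0; last first.
    by move=> k nk _; rewrite ediamU0// expe2 mule0.
  apply: (@le_trans _ _ ((pi / 4)%:E * (9 * \sum_(0 <= k < 2 ^ n) X k ^+ 2)%:E)%E).
    rewrite lee_wpmul2l ?lee_fin// mulr_sumr -sumEFin big_nat [leRHS]big_nat.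
    apply: lee_sum => k /andP[_ kn]; rewrite /U kn.
    rewrite (_ : 9 * X k ^+ 2 = (3 * X k) * (3 * X k)); last by lra.
    by rewrite expe2 EFinM lee_pmul// ?ediam_ge0// ediam_square.
  rewrite -EFinM lee_fin.
  have : \sum_(0 <= k < 2 ^ n) X k ^+ 2 <= e / (9 * pi).
    by apply: le_trans Xsum _; rewrite ge_min lexx.
  rewrite ler_pdivlMr ?mulr_gt0 ?pi_gt0// => h.
  by move: (\sum_(_ <= _ < _) _) h => s h; lra.
rewrite /hausdorff2; apply/eqP; rewrite eq_le; apply/andP; split.
  by apply: ge_ereal_sup => _ [delta delta0 <-]; rewrite pre0.
by apply: ereal_sup_ubound; exists 1; [exact: ltr01|exact: pre0].
Qed.

Definition node_squares {R : realType} (C : R) (g : R -> R * R) (m : nat) :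
    set (plane R) :=
  \big[setU/set0]_(j < 2 ^ m) square (node g m j) (Num.sqrt (C ^+ 2 / 2 ^+ m)).

(** A point outside the curve has a positive distance from it, and the
squares around the nodes shrink to points of the curve. *)
Lemma curve_image_squares (R : realType) (C : R) (g : R -> R * R) :
  closed_curve g -> holder_sqr C g ->
  (curve_image g : set (plane R)) = \bigcap_m node_squares C g m.
Proof.
move=> g01 hg; apply/seteqP; split => [_ [t t01 <-] m _|z zm].
  have [k km near_k] := curve_node m g01 hg t01.
  rewrite /node_squares -(bigcup_mkord _ (fun j => square (node g m j) _)).
  exists k => //; apply/in_square.
  have le_s : enorm (g t - node g m k) <= Num.sqrt (C ^+ 2 / 2 ^+ m).
    by rewrite -[leLHS]ger0_norm ?enorm_ge0// -sqrtr_sqr ler_wsqrtr.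
  split; [exact: le_trans (enorm_fst _) le_s|exact: le_trans (enorm_snd _) le_s].
apply: contrapT => gz; have [r r0 rg] := distance_to_curve hg gz.
have : (fun m => 2 * C ^+ 2 / 2 ^+ m) @ \oo --> (0 : R).
  rewrite -[0](mulr0 (2 * C ^+ 2)); apply: cvgM; first exact: cvg_cst.
  under eq_fun do rewrite -exprVn.
  by apply: cvg_expr; rewrite ger0_norm ?invr_ge0// invf_lt1 ?ltr1n.
have r2 : 0 < r ^+ 2 by rewrite exprn_gt0.
move=> /cvgr_lt/(_ _ r2)[m _ /(_ m (leqnn _))/= hm].
have := zm m I; rewrite /node_squares -(bigcup_mkord _ (fun j => square (node g m j) _)).
move=> [j jm /in_square[z1 z2]].
have := rg _ (dyadic_itv R (ltnW jm)); rewrite -/(node g m j) leNgt.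
apply/negP; rewrite negbK.
rewrite -ltr_sqr ?nnegrE ?enorm_ge0//; last exact: ltW.
apply: le_lt_trans hm; rewrite enorm_sqr/=.
have s2 : Num.sqrt (C ^+ 2 / 2 ^+ m) ^+ 2 = C ^+ 2 / 2 ^+ m.
  by rewrite sqr_sqrtr// divr_ge0 ?sqr_ge0// exprn_ge0.
have sq (x y : R) : `|x - y| <= Num.sqrt (C ^+ 2 / 2 ^+ m) ->
    (y - x) ^+ 2 <= C ^+ 2 / 2 ^+ m.
  move=> xy; rewrite -s2 -real_normK ?num_real// distrC.
  by rewrite ler_sqr ?nnegrE ?sqrtr_ge0.
rewrite -mulrA; have := sq _ _ z1; have := sq _ _ z2; lra.
Qed.

Lemma measurable_curve_image (R : realType) (C : R) (g : R -> R * R) :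
  closed_curve g -> holder_sqr C g ->
  measurable (curve_image g : set (plane R)).
Proof.
move=> g01 hg; rewrite (curve_image_squares g01 hg).
apply: bigcapT_measurable => m; apply: bigsetU_measurable => j _.
exact: measurable_square.
Qed.

Lemma curve_image_null (R : realType) (C : R) (g : R -> R * R)
    (E : nat -> nat -> R) :
  closed_curve g -> holder_sqr C g -> dyadic_system C (node g) E ->
  (\sum_(0 <= m <oo) (\sum_(0 <= j < 2 ^ m) E m j)%:E < +oo)%E ->
  lebesgue_plane (curve_image g : set (plane R)) = 0%E.
Proof.
move=> g01 hg sys Esum; have mI := measurable_curve_image g01 hg.
apply/eqP; rewrite eq_le measure_ge0 andbT; apply/lee_addgt0Pr => e e0.
rewrite add0e; have e4 : 0 < e / 4 by rewrite divr_gt0.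
have [n [X [X0 Xsum Xcov]]] := squares_cover g01 hg sys Esum e4.
pose U : set (plane R) := \big[setU/set0]_(j < 2 ^ n) square (node g n j) (X j).
have mU : measurable U.
  by apply: bigsetU_measurable => j _; exact: measurable_square.
apply: (@le_trans _ _ (lebesgue_plane U)).
  apply: le_measure; rewrite ?inE// => _ [t t01 <-].
  have [k kn gt] := Xcov t t01.
  rewrite /U -(bigcup_mkord _ (fun j => square (node g n j) (X j))).
  by exists k.
apply: le_trans (@Boole_inequality _ _ _ lebesgue_plane
  (fun j => square (node g n j) (X j)) (2 ^ n) _) _.
  by move=> j _; exact: measurable_square.
rewrite (eq_bigr (fun j : 'I_(2 ^ n) => (4 * X j ^+ 2)%:E)); last first.
  by move=> j _; exact: square_measure.
rewrite sumEFin lee_fin -mulr_sumr -(big_mkord xpredT (fun j => X j ^+ 2)).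
lra.
Qed.

(** * The winding function and the signed area *)

Lemma wind_cvg (R : realType) (C : R) (g : R -> R * R) (z : R * R) :
  closed_curve g -> holder_sqr C g -> ~ curve_image g z ->
  (fun m => polygon_wind g m z) @ \oo --> wind g z.
Proof.
move=> g01 hg gz; apply: cvg_near_cst; have := wind_polygon g01 hg gz.
by apply: filterS => m ->.
Qed.

(** On the curve the winding functions of the polygons need not converge; they
are replaced there by 0, the conventional value of [wind]. *)
Lemma measurable_wind (R : realType) (C : R) (g : R -> R * R) :
  closed_curve g -> holder_sqr C g ->
  measurable_fun setT (wind g : plane R -> R).
Proof.
move=> g01 hg; have mI := measurable_curve_image g01 hg.
apply: (measurable_fun_cvg
  (h := fun m z => polygon_wind g m z * \1_(~` (curve_image g : set (plane R))) z)).
  move=> m; apply: measurable_funM; last exact/measurable_indic/measurableC.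
  by apply/measurable_EFinP; exact: measurable_int (integrable_polygon_wind m g01 hg).
move=> z _; have [gz|gz] := pselect (curve_image g z).
  rewrite wind_image//; under eq_fun do rewrite indicE memNset ?mulr0//.
  exact: cvg_cst.
under eq_fun do rewrite indicE mem_set// mulr1.
exact: wind_cvg g01 hg gz.
Qed.

(** Dominated convergence; the polygons converge off the curve, which is a
null set. *)
Lemma wind_integral (R : realType) (C : R) (g : R -> R * R)
    (E : nat -> nat -> R) :
  closed_curve g -> holder_sqr C g -> dyadic_system C (node g) E ->
  (\sum_(0 <= m <oo) (\sum_(0 <= j < 2 ^ m) E m j)%:E < +oo)%E ->
  lebesgue_plane.-integrable setT (EFin \o wind g) /\
  shoelace g @ \oo --> fine (\int[lebesgue_plane]_z (wind g z)%:E)%E.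
Proof.
move=> g01 hg sys Esum.
have null := curve_image_null g01 hg sys Esum.
have [||||| int_wind _ cvg_int] := @dominated_convergence _ _ R lebesgue_plane setT
    measurableT (fun m => EFin \o polygon_wind g m) (EFin \o wind g) (wind_bound g E).
- by move=> m; exact: measurable_int (integrable_polygon_wind m g01 hg).
- by apply/measurable_EFinP; exact: measurable_wind g01 hg.
- exists (curve_image g); split => //; first exact: measurable_curve_image g01 hg.
  move=> z /=; apply: contra_notP => gz _.
  by apply: cvg_EFin; [exact: nearW|exact: wind_cvg g01 hg gz].
- by apply: integrable_wind_bound => //; exact: dyadic_E_ge0 sys.
- exists set0; split => // z /=; case => m _.
  exact: polygon_wind_dominated g01 sys.
split=> //; move: cvg_int; under eq_fun do rewrite (integral_polygon_wind _ g01 hg).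
move=> cvg_int; have fin : (\int[lebesgue_plane]_z (wind g z)%:E)%E \is a fin_num.
  exact: integrable_fin_num.
have : (fun m => (shoelace g m)%:E) @ \oo -->
    (fine (\int[lebesgue_plane]_z (wind g z)%:E)%E)%:E by rewrite fineK.
by move=> /fine_cvg.
Qed.

Lemma cvg_dyadic_rate (R : realType) (c : R) (u : nat -> R) (l : R) :
  (forall m, `|l - u m| ^+ 2 <= c / 2 ^+ m) -> u @ \oo --> l.
Proof.
move=> ul; apply/cvgrPdist_lt => eps eps0.
have : (fun m => c / 2 ^+ m) @ \oo --> (0 : R).
  rewrite -[0](mulr0 c); apply: cvgM; first exact: cvg_cst.
  under eq_fun do rewrite -exprVn.
  by apply: cvg_expr; rewrite ger0_norm ?invr_ge0// invf_lt1 ?ltr1n.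
have e2 : 0 < eps ^+ 2 by rewrite exprn_gt0.
move=> /cvgr_lt/(_ _ e2); apply: filterS => m cm.
rewrite -ltr_sqr ?nnegrE//; last exact: ltW.
exact: le_lt_trans (ul m) cm.
Qed.

Definition trunc_dyadic {R : realType} (m : nat) (t : R) : nat :=
  Num.truncn (t * 2 ^+ m).

Lemma cross_trunc_cvg (R : realType) (C : R) (g : R -> R * R) (s t : R) :
  holder_sqr C g -> s \in `[0, 1] -> t \in `[0, 1] ->
  (fun m => cross (node g m (trunc_dyadic m s)) (node g m (trunc_dyadic m t)))
    @ \oo --> cross (g s) (g t).
Proof.
move=> hg s01 t01.
have fstc u : u \in `[0, 1] ->
    (fun m => (node g m (trunc_dyadic m u)).1) @ \oo --> (g u).1.
  move=> u01; apply: (@cvg_dyadic_rate _ (C ^+ 2)) => m.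
  have [_ _] := trunc_node m hg u01; apply: le_trans.
  by rewrite ler_sqr ?nnegrE ?enorm_ge0//; exact: (enorm_fst (_ - _)).
have sndc u : u \in `[0, 1] ->
    (fun m => (node g m (trunc_dyadic m u)).2) @ \oo --> (g u).2.
  move=> u01; apply: (@cvg_dyadic_rate _ (C ^+ 2)) => m.
  have [_ _] := trunc_node m hg u01; apply: le_trans.
  by rewrite ler_sqr ?nnegrE ?enorm_ge0//; exact: (enorm_snd (_ - _)).
by apply: cvgB; apply: cvgM; (exact: fstc || exact: sndc).
Qed.

(** With default value 1 the points of the partition extend to a nondecreasing
sequence. *)
Lemma partition_points (R : realType) (s : seq R) : itv_partition 0 1 s ->
  let t := nth 1 (0 :: s) in
  [/\ forall i, t i \in `[0, 1], {homo t : i j / (i <= j)%N >-> i <= j},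
      t (size s) = 1 &
      forall i, (i < size s)%N ->
        (0 :: s)`_i = t i /\ (0 :: s)`_i.+1 = t i.+1].
Proof.
move=> ps t.
have tlast : t (size s) = 1 by exact: itv_partition_nth_size ps.
have tover i : (size s < i)%N -> t i = 1.
  by move=> si; apply: nth_default.
have t01 i : t i \in `[0, 1].
  rewrite in_itv/=; have [si|si] := ltnP (size s) i.
    by rewrite tover// ler01 lexx.
  by rewrite (itv_partition_nth_ge _ ps)// (itv_partition_nth_le _ ps).
split=> //.
  apply: homo_leq => [x|y x z|i]; [exact: lexx|exact: le_trans|].
  have [si|si] := ltnP i (size s); last first.
    by rewrite (tover i.+1)//; have := t01 i; rewrite in_itv/= => /andP[].
  by have /pathP/(_ _ si) := ps.1 => /(_ 1)/ltW.
move=> i si; split; apply: set_nth_default => //=; exact: ltnW.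
Qed.

(** For a mesh below [2 ^- n.+1], consecutive points truncated to level
[n + r.+1] are less than [2 ^ r.+1] nodes apart, so that [polygon_refinement]
involves only the levels above [n].  Letting [r] tend to infinity, the dyadic
polygon tends to [A] and the truncated partition to the given one. *)
Lemma signed_area_limit (R : realType) (C : R) (g : R -> R * R)
    (E : nat -> nat -> R) (A : R) :
  holder_sqr C g -> dyadic_system C (node g) E ->
  (\sum_(0 <= m <oo) (\sum_(0 <= j < 2 ^ m) E m j)%:E < +oo)%E ->
  shoelace g @ \oo --> A -> signed_area_is g A.
Proof.
move=> hg sys Esum cvgA eps eps0; have E0 := dyadic_E_ge0 sys.
have eps2 : 0 < eps / 2 by rewrite divr_gt0.
have [K K0 refine] := polygon_refinement C eps2.
have K1 : 0 < K + 1 by rewrite ltr_wpDl.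
pose S m := \sum_(0 <= j < 2 ^ m) E m j.
have S0 m : 0 <= S m by rewrite sumr_ge0.
have e0 : 0 < eps / 2 / (K + 1) by rewrite !divr_gt0.
have [n tail] := dyadic_tail S0 Esum e0.
have m0 m : 0 < 2 ^+ m :> R by rewrite exprn_gt0.
exists (2 ^+ n.+1)^-1; first by rewrite invr_gt0.
move=> s ps mesh; have [t01 tmono tlast tnth] := partition_points ps.
set t := nth 1 (0 :: s) in t01 tmono tlast tnth.
have step i : (i < size s)%N -> t i.+1 - t i < (2 ^+ n.+1)^-1.
  move=> si; apply: le_lt_trans mesh; rewrite /partition_mesh.
  have [<- <-] := tnth i si.
  exact: (le_bigmax _ (fun j : 'I_(size s) => (0 :: s)`_j.+1 - (0 :: s)`_j) (Ordinal si)).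
pose Q m := \sum_(i < size s)
  cross (node g m (trunc_dyadic m (t i))) (node g m (trunc_dyadic m (t i.+1))).
have cvgQ : (fun m => shoelace g m - 2^-1 * Q m) @ \oo --> A - partition_area g s.
  apply: cvgB => //; rewrite /partition_area; apply: cvgM; first exact: cvg_cst.
  rewrite (eq_bigr (fun i : 'I_(size s) => cross (g (t i)) (g (t i.+1)))); last first.
    by move=> i _; have [-> ->] := tnth i (ltn_ord i).
  apply: cvg_big => [|i _]; first exact: add_continuous.
  exact: (cross_trunc_cvg hg (t01 i) (t01 i.+1)).
have bound r : `|shoelace g (n + r.+1)%N - 2^-1 * Q (n + r.+1)%N| <= eps / 2.
  set N := (n + r.+1)%N; pose p i := trunc_dyadic N (t i).
  have t_ge0 i : 0 <= t i by have := t01 i; rewrite in_itv/= => /andP[].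
  have pmono : {homo p : i j / (i <= j)%N}.
    by move=> i j ij; apply: le_truncn; rewrite ler_pM2r// tmono.
  have p0 : p 0%N = 0%N by rewrite /p /trunc_dyadic/= mul0r truncn0.
  have pk : p (size s) = (2 ^ N)%N.
    by rewrite /p /trunc_dyadic tlast mul1r -natrX natrK.
  have pstep i : (i < size s)%N -> (p i.+1 - p i < 2 ^ r.+1)%N.
    move=> si; have := step i si.
    have /truncn_itv/andP[_ lo] : 0 <= t i * 2 ^+ N by rewrite mulr_ge0// ltW.
    have /truncn_itv/andP[hi _] : 0 <= t i.+1 * 2 ^+ N by rewrite mulr_ge0// ltW.
    rewrite -(ltr_pM2r (m0 N)) mulrBl (_ : _^-1 * _ = 2 ^+ r); last first.
      by rewrite /N -addSnnS exprD mulKf// expf_neq0.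
    move=> d; have : (p i.+1)%:R < (p i + 2 ^ r + 1)%N%:R :> R.
      by rewrite !natrD natrX; move: lo hi; rewrite -/(trunc_dyadic N _)
        -/(p i) -/(trunc_dyadic N _) -/(p i.+1) -natr1; lra.
    rewrite ltr_nat expnS; have : (0 < 2 ^ r)%N by rewrite expn_gt0.
    by clear; lia.
  have := refine (node g) E n r.+1 (size s) p sys pmono p0 pk pstep.
  rewrite -/N => main.
  have Ktail : K * (\sum_(n.+1 <= m < N.+1) S m) <= eps / 2.
    have le_tail : \sum_(n.+1 <= m < N.+1) S m <= eps / 2 / (K + 1).
      apply: le_trans (ltW (tail r.+2)); rewrite -/N addnS.
      by rewrite [leRHS]big_ltn ?lerDr// ltnS leq_addr.
    have T0 : 0 <= \sum_(n.+1 <= m < N.+1) S m by rewrite sumr_ge0.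
    move: le_tail; rewrite ler_pdivlMr//; lra.
  rewrite /shoelace -mulrBr normrM ger0_norm ?invr_ge0//.
  rewrite ler_pdivrMl//; apply: le_trans main _; rewrite -/S; lra.
have : `|A - partition_area g s| <= eps / 2.
  have /cvg_norm cvgQn := cvgQ; rewrite -(cvg_lim _ cvgQn)//.
  apply: limr_le; first by apply/cvg_ex; eexists; exact: cvgQn.
  exists n.+1 => // N /= nN; have := bound (N - n.+1)%N.
  by rewrite -addSnnS subnKC.
lra.
Qed.

Theorem propositionB8 (R : realType) (gamma : R -> R * R)
  (gamma_closed : closed_curve gamma)
  (gamma_holder : holder_curve 2^-1 gamma)
  (gamma_sum : (\sum_(0 <= i <oo) \sum_(0 <= j < 2 ^ i)
                  ediam (dyadic_triple gamma i j) ^+ 2 < +oo)%E) :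
  [/\ hausdorff2 (curve_image gamma) = 0%E,
      lebesgue_plane.-integrable setT (EFin \o wind gamma) &
      exists A : R, signed_area_is gamma A /\
        (\int[lebesgue_plane]_z (wind gamma z)%:E = A%:E)%E].
Proof.
have [C C0 hg] := holder_curve_sqr gamma_holder.
have sys := triple_system C0 hg.
have Esum : (\sum_(0 <= m <oo)
    (\sum_(0 <= j < 2 ^ m) triple_energy gamma m j)%:E < +oo)%E.
  rewrite (eq_eseriesr (g := fun m =>
    (\sum_(0 <= j < 2 ^ m) ediam (dyadic_triple gamma m j) ^+ 2)%E))//.
  move=> m _; rewrite -sumEFin; apply: eq_bigr => j _.
  by rewrite triple_energyE.
have [int_wind cvg_area] := wind_integral gamma_closed hg sys Esum.
split=> //; first exact: hausdorff2_image gamma_closed hg sys Esum.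
exists (fine (\int[lebesgue_plane]_z (wind gamma z)%:E)%E); split.
  exact: signed_area_limit hg sys Esum cvg_area.
by rewrite fineK//; exact: integrable_fin_num.
Qed.
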